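(* Let $I$ be a homogeneous perfect ideal of height $2$ of $S=K[X_1,\dots,X_n]$. Each of the following conditions is sufficient to guarantee that in any standard basis of $I$ all the elements are essential: (i) $\nu(I)<n+1$; (ii) $\alpha(I)<n$; (iii) $e(I)<\dfrac{n(n+1)}{2}$.
   Context: $K$ is an algebraically closed field, $S=K[X_1,\dots,X_n]$, $\mathfrak M=(X_1,\dots,X_n)$. An ideal is perfect of height $2$ if it has height $2$ and the projective dimension of $S/I$ is $2$. For a homogeneous ideal $I=\bigoplus_d I_d$, a standard basis of $I$ is an ordered set of forms generating $I$ such that its elements of degree $d$ define a $K$-basis of $I_d/(I_{d-1}S_1)$ for every $d$. $\nu(I)$ is the number of elements of a standard basis, $\alpha(I)$ the smallest degree of its elements, and $e(I)$ is the multiplicity of $S/I$ (for $\dim S/I=0$, $e(I)=\dim_K S/I$). Given a standard basis $\mathcal B$ of $I$, an element $f\in\mathcal B$ is inessential with respect to $\mathcal B$ if there is $t\in\mathbb N$ with $f\,\mathfrak M^t\subseteq(\mathcal B\setminus\{f\})S$; otherwise $f$ is essential. *)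

(* Defs.v *)
From HB Require Import structures.
From mathcomp Require Import all_boot all_order all_algebra.
From mathcomp Require Import generic_quotient ring_quotient.
From mathcomp Require Export mpoly.

Set Implicit Arguments.
Unset Strict Implicit.
Unset Printing Implicit Defensive.

Import GRing.Theory.
Local Open Scope ring_scope.
Local Open Scope quotient_scope.

(* Ideals are MathComp's [idealr] and [prime_idealr]: proper ideals with a
   boolean membership predicate; classically every proper ideal is of this
   form. *)

Section QuotientModule.
Variables (R : comNzRingType) (I : idealr R).

Definition iq_scale (a : R) (x : {ideal_quot I}) : {ideal_quot I} :=
  \pi_{ideal_quot I} a * x.

Lemma iq_scaleA a b x : iq_scale a (iq_scale b x) = iq_scale (a * b) x.
Proof. by rewrite /iq_scale rmorphM mulrA. Qed.

Lemma iq_scale1 : left_id 1 iq_scale.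
Proof. by move=> x; rewrite /iq_scale rmorph1 mul1r. Qed.

Lemma iq_scaleDr : right_distributive iq_scale +%R.
Proof. by move=> a x y; rewrite /iq_scale mulrDr. Qed.

Lemma iq_scaleDl x : {morph iq_scale^~ x : a b / a + b}.
Proof. by move=> a b; rewrite /iq_scale rmorphD mulrDl. Qed.

HB.instance Definition _ := GRing.Zmodule_isLmodule.Build R {ideal_quot I}
  iq_scaleA iq_scale1 iq_scaleDr iq_scaleDl.

End QuotientModule.

Section Ideals.
Variable R : comNzRingType.

Definition ideal_gen (G : R -> Prop) (x : R) : Prop :=
  exists s : seq (R * R),
    {in s, forall u, G u.2} /\ x = \sum_(u <- s) u.1 * u.2.

Definition ideal_pow (J : R -> Prop) (t : nat) : R -> Prop :=
  ideal_gen (fun x => exists s : seq R,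
    [/\ size s = t, {in s, forall a, J a} & x = \prod_(a <- s) a]).

(* There is a chain Q 0 < ... < Q k = P of prime ideals; the values of Q
   beyond k are irrelevant. *)
Definition prime_chain (P : prime_idealr R) (k : nat) : Prop :=
  exists Q : nat -> prime_idealr R,
    Q k =i P /\
    forall i, (i < k)%N ->
      {subset Q i <= Q i.+1} /\ ~ {subset Q i.+1 <= Q i}.

Definition prime_height (P : prime_idealr R) (h : nat) : Prop :=
  prime_chain P h /\ forall k, prime_chain P k -> (k <= h)%N.

Definition height (I : idealr R) (h : nat) : Prop :=
  (exists P : prime_idealr R, {subset I <= P} /\ prime_height P h) /\
  (forall (P : prime_idealr R) k,
     {subset I <= P} -> prime_height P k -> (h <= k)%N).

Definition projective (P : lmodType R) : Prop :=
  forall (A B : lmodType R) (g : {linear A -> B}) (f : {linear P -> B}),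
    (forall b, exists a, g a = b) ->
    exists h : {linear P -> A}, forall x, g (h x) = f x.

(* M has a projective resolution ... -> P 1 -> P 0 -> M -> 0 with P i = 0
   for i > k. *)
Definition proj_dim_le (M : lmodType R) (k : nat) : Prop :=
  exists (P : nat -> lmodType R) (d : forall i, {linear P i.+1 -> P i})
         (eps : {linear P 0%N -> M}),
    [/\ forall i, projective (P i),
        forall i, (k < i)%N -> forall x : P i, x = 0,
        forall m, exists x, eps x = m,
        forall x, eps x = 0 <-> exists y, d 0%N y = x
      & forall i x, d i x = 0 <-> exists y, d i.+1 y = x].

Definition proj_dim (M : lmodType R) (k : nat) : Prop :=
  proj_dim_le M k /\ forall j, proj_dim_le M j -> (k <= j)%N.

Definition perfect_of_height2 (I : idealr R) : Prop :=
  height I 2 /\ proj_dim {ideal_quot I} 2.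

End Ideals.

Section Forms.
Variables (K : fieldType) (n : nat).
Local Notation S := {mpoly K[n]}.
Implicit Types (I : idealr S) (B : seq S).

Definition maxI : S -> Prop := ideal_gen (fun x => exists i : 'I_n, x = 'X_i).

Definition homogeneous_ideal I : Prop :=
  forall p d, p \in I -> pihomog mdeg d p \in I.

(* The classes of the elements of s form a K-basis of V / W, for K-subspaces
   W <= V of S. *)
Definition basis_mod (V W : S -> Prop) (s : seq S) : Prop :=
  [/\ {in s, forall f, V f},
      forall g, V g -> exists c : 'I_(size s) -> K,
        W (g - \sum_(i < size s) c i *: s`_i)
    & forall c : 'I_(size s) -> K,
        W (\sum_(i < size s) c i *: s`_i) -> forall i, c i = 0].

Definition form_of_degree (d : nat) (p : S) : Prop := p \is d.-homog.

Definition ideal_part I (d : nat) (p : S) : Prop := p \in I /\ p \is d.-homog.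

(* The K-subspace I_(d-1) S_1 of S_d, which is 0 for d = 0. *)
Definition pred_part_mul I (d : nat) (p : S) : Prop :=
  exists s : seq (S * S),
    {in s, forall u, [/\ (0 < d)%N, ideal_part I d.-1 u.1
                       & form_of_degree 1 u.2]} /\
    p = \sum_(u <- s) u.1 * u.2.

Definition standard_basis I B : Prop :=
  [/\ {in B, forall f, exists d, f \is d.-homog},
      forall p, p \in I <-> ideal_gen (fun g => g \in B) p
    & forall d, basis_mod (ideal_part I d) (pred_part_mul I d)
                          [seq f <- B | f \is d.-homog]].

Definition is_nu I (k : nat) : Prop :=
  exists B, standard_basis I B /\ size B = k.

Definition is_alpha I (d0 : nat) : Prop :=
  exists B, [/\ standard_basis I B,
                exists2 f, f \in B & f \is d0.-homog
              & forall f d, f \in B -> f \is d.-homog -> (d0 <= d)%N].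

Definition hilbert_function I (H : nat -> nat) : Prop :=
  forall t, exists s : seq S,
    basis_mod (form_of_degree t) (ideal_part I t) s /\ size s = H t.

(* Q is the Hilbert polynomial of S/I. If Q = 0, i.e. dim S/I = 0, then
   e = \sum_(t < t0) H t = dim_K S/I; otherwise Q has degree dim S/I - 1 and
   e is the normalized leading coefficient of Q. *)
Definition is_multiplicity I (e : rat) : Prop :=
  exists (H : nat -> nat) (Q : {poly rat}) (t0 : nat),
    [/\ hilbert_function I H,
        forall t, (t0 <= t)%N -> (H t)%:R = Q.[t%:R]
      & e = if Q == 0 then (\sum_(t < t0) H t)%:R
            else ((size Q).-1)`!%:R * lead_coef Q].

Definition inessential B (f : S) : Prop :=
  exists t : nat, forall m, ideal_pow maxI t m ->
    ideal_gen (fun g => g \in B /\ g <> f) (f * m).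

Definition essential B (f : S) : Prop := ~ inessential B f.

End Forms.

(* Main.v *)
Require Import Defs.
From HB Require Import structures.
From mathcomp Require Import all_boot all_order all_algebra.
From mathcomp Require Import fingroup perm.
From mathcomp Require Import generic_quotient ring_quotient mpoly freeg.
From Stdlib Require Import Classical.

Set Implicit Arguments.
Unset Strict Implicit.
Unset Printing Implicit Defensive.

Import Order.TTheory GRing.Theory Num.Theory.
Local Open Scope ring_scope.
Local Open Scope quotient_scope.

(** Let f_1, ..., f_nu be a standard basis of I, of degrees d_i, and let Z be the
    module of its syzygies; minimality means that Z lies in M S^nu, where M is
    the irrelevant ideal.

    Since S/I has projective dimension at most 2, Z is free.  A projective
    resolution of S/I of length 2, whose modules may be of infinite rank, is
    compared with the start S^nu -> S -> S/I of a resolution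
    (comparison_of_resolutions): every surjection A -> Z admits a section up to
    M Z.  For A free on the elements of Z this makes syzygies that are
    K-independent modulo M Z independent over S (indep_syzygies), so there are
    at most nu of them, and by the graded Nakayama argument a maximal
    homogeneous family z_1, ..., z_m, of degrees e_j, is a basis of Z
    (free_graded_syzygies).  Its rank m is nu - 1 (syzygies_row_number).

    If f_k is inessential, then the coefficients at f_k of z_1, ..., z_m
    generate an ideal containing a power of M.  They are m forms of positive
    degree, so m >= n by a dimension count (krull_height_bound), that is
    nu >= n + 1, which excludes (i).

    For (ii), S is written as K[X'][t] in generic coordinates and the nonzero
    elements of K[X'] are inverted (generic_line).  Over the resulting principal
    ideal domain F[t] the Hilbert-Burch theorem is elementary
    (hilbert_burch_pid): f_i is g times the i-th maximal minor of the relation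
    matrix, up to a unit.  For generic coordinates the t-degree of a form is its
    degree; comparing degrees gives d_i = deg g + sum_j (e_j - d_(s j)) for a
    bijection s, where every summand is at least 1 (degree_numerics).  Hence
    d_i >= m >= n, which excludes (ii).  If g were not constant, an irreducible
    factor of g would contract to a prime of height one containing I; so
    height 2 forces deg g = 0 (degree_formula).

    For (iii), the resolution 0 -> S^m -> S^nu -> S gives the Hilbert function
    of S/I (hilbert_function_count), hence 2 e(I) = sum_j e_j^2 - sum_i d_i^2 for
    n >= 3 (hilbert_poly_lead).  With u_j = e_j - d_(s j) and the smallest
    d_i = sum_j u_j this is at least (sum_j u_j)^2 + sum_j u_j^2 >= m (m + 1)
    (degree_sums), so e(I) >= n (n + 1) / 2, which excludes (iii).  For n <= 2
    the multiplicity is the sum of the Hilbert function, which is bounded below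
    by its values in the degrees smaller than n, where I vanishes. *)

(** * Comparing a projective resolution with the syzygies of the generators *)

Section Submodules.
Variables (R : comNzRingType) (I : idealr R) (nu : nat) (b : 'cV[R]_nu).

Definition syzygies : {pred 'rV[R]_nu} := fun c => c *m b == 0.

Lemma syzygies_submod_closed : submod_closed syzygies.
Proof.
split=> [|a u v]; first by rewrite /in_mem /= /syzygies mul0mx.
rewrite /in_mem /= /syzygies => /eqP hu /eqP hv.
by rewrite mulmxDl -scalemxAl hu hv scaler0 addr0.
Qed.
HB.instance Definition _ :=
  GRing.isSubmodClosed.Build R 'rV[R]_nu syzygies syzygies_submod_closed.

Record syz_module := Syz { syz_val :> 'rV[R]_nu; _ : syz_val \in syzygies }.
HB.instance Definition _ := [isSub for syz_val].
HB.instance Definition _ := [Choice of syz_module by <:].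
HB.instance Definition _ := [SubChoice_isSubLmodule of syz_module by <:].

Lemma syz_val_linear : linear syz_val.
Proof. by []. Qed.
HB.instance Definition _ :=
  GRing.isLinear.Build R syz_module 'rV[R]_nu _ syz_val syz_val_linear.

Lemma syz_module0 (z : syz_module) : syz_val z *m b = 0.
Proof. by apply/eqP; exact: (valP z). Qed.

Definition ideal_pred : {pred R^o} := fun x => x \in I.
Lemma ideal_submod_closed : submod_closed ideal_pred.
Proof.
split=> [|a u v]; first exact: (idealr0 I).
rewrite /in_mem /= /ideal_pred => hu hv.
by apply: rpredD => //; apply: idealMr.
Qed.
HB.instance Definition _ :=
  GRing.isSubmodClosed.Build R R^o ideal_pred ideal_submod_closed.

Record ideal_module := Imod { imod_val :> R^o; _ : imod_val \in ideal_pred }.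
HB.instance Definition _ := [isSub for imod_val].
HB.instance Definition _ := [Choice of ideal_module by <:].
HB.instance Definition _ := [SubChoice_isSubLmodule of ideal_module by <:].

End Submodules.

(** Linear maps into submodules arise below as bare functions; this bundles them
    for use with the lifting property of projective modules. *)
Definition mk_linear (R : comNzRingType) (U V : lmodType R) (f : U -> V)
    (lin : linear f) : {linear U -> V} :=
  HB.pack f (GRing.isLinear.Build R U V *:%R f lin).

Section Comparison.
Variables (R : comNzRingType) (I : idealr R) (nu : nat) (b : 'cV[R]_nu).
Hypothesis genI : forall p, p \in I <-> exists c : 'rV_nu, p = (c *m b) 0 0.

Lemma gen_in_ideal (c : 'rV[R]_nu) : (c *m b) 0 0 \in I.
Proof. by apply/genI; exists c. Qed.

(** Lift the identity of R/I to maps beta_i from the projective resolution P to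
    R <- R^nu <- A (the last one through Z), and choose elements p_0 of P_0 over 1
    and p_i of P_1 over b_i p_0.  As the resolution has length 2, P_2 -> P_1 is
    injective, so each syzygy x has a unique lift q x in P_2 of sum_i x_i p_i, and
    q is linear.  The section up to M Z is s = beta_2 o q; the rows of the error
    matrix Y are beta_1 p_i - e_i - b_i h, where beta_0 p_0 = 1 + h b. *)
Lemma comparison_of_resolutions :
  proj_dim_le {ideal_quot I} 2 ->
  forall (A : lmodType R) (g : {linear A -> syz_module b}),
    (forall z, exists a, g a = z) ->
  exists (s : {linear syz_module b -> A}) (Y : 'M[R]_nu),
    Y *m b = 0 /\ forall z, syz_val (g (s z)) = syz_val z + syz_val z *m Y.
Proof.
case=> [P [d [eps [projP P0 epsS exact0 exactS]]]] A g gS.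
have pi_lin : linear (fun x : R^o => \pi_{ideal_quot I} (x : R)).
  by move=> a x y; rewrite /= rmorphD rmorphM.
have piS (q : {ideal_quot I}) : exists x : R^o, mk_linear pi_lin x = q.
  by exists (repr q); rewrite /= reprK.
(* beta_0, beta_1, beta_2 are lifts along R -> R/I, R^nu -> I and A -> Z *)
have [beta0 hbeta0] := projP 0%N _ _ (mk_linear pi_lin) eps piS.
have pi0 (x : R) : \pi_{ideal_quot I} x = 0 <-> x \in I.
  rewrite -(rmorph0 (\pi_{ideal_quot I})); split=> [/eqP|h].
    by rewrite -Quotient.idealrBE subr0.
  by apply/eqP; rewrite -Quotient.idealrBE subr0.
have beta0I x : (beta0 (d 0%N x) : R) \in I.
  apply/pi0; have /= -> := hbeta0 (d 0%N x).
  by apply/exact0; exists x.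
pose bd x : ideal_module I := Imod (beta0I x).
have bd_lin : linear bd.
  by move=> a x y; apply: val_inj => /=; rewrite !linearP.
pose bI (c : 'rV_nu) : ideal_module I := Imod (gen_in_ideal c).
have bI_lin : linear bI.
  move=> a x y; apply: val_inj => /=.
  by rewrite mulmxDl -scalemxAl !mxE.
have bIS (q : ideal_module I) : exists c, mk_linear bI_lin c = q.
  by have [c hc] := (genI (val q)).1 (valP q); exists c; apply: val_inj.
have [beta1 hbeta1] := projP 1%N _ _ (mk_linear bI_lin) (mk_linear bd_lin) bIS.
have {}hbeta1 x : (beta1 x *m b) 0 0 = beta0 (d 0%N x).
  by have /(congr1 val) := hbeta1 x.
have mx11P (M : 'M[R]_1) : M 0 0 = 0 -> M = 0.
  by move=> h; apply/matrixP=> i j; rewrite !ord1 h mxE.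
have beta1Z x : beta1 (d 1%N x) \in syzygies b.
  apply/eqP; apply: mx11P; rewrite hbeta1.
  suff -> : d 0%N (d 1%N x) = 0 by rewrite linear0.
  by apply/exactS; exists x.
pose zd x : syz_module b := Syz (beta1Z x).
have zd_lin : linear zd.
  by move=> a x y; apply: val_inj => /=; rewrite !linearP.
have [beta2 hbeta2] := projP 2%N _ _ g (mk_linear zd_lin) gS.
have d1inj : injective (d 1%N).
  move=> x y /eqP; rewrite -subr_eq0 -linearB => /eqP /exactS [w hw].
  apply/eqP; rewrite -subr_eq0 -hw.
  by rewrite (P0 3%N isT w) linear0.
have [p0 hp0] := epsS (\pi_{ideal_quot I} 1).
have /fin_all_exists [p hp] (i : 'I_nu) : exists q, d 0%N q = b i 0 *: p0.
  apply/exact0; rewrite linearZ /= hp0.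
  have -> : b i 0 *: \pi_({ideal_quot I}) 1 = \pi_({ideal_quot I}) (b i 0 * 1).
    by rewrite rmorphM.
  apply/pi0; rewrite mulr1; apply/genI; exists (delta_mx 0 i).
  by rewrite -rowE mxE.
have q_ex (z : syz_module b) : exists q, d 1%N q = \sum_i syz_val z 0 i *: p i.
  apply/exactS; rewrite linear_sum /=.
  under eq_bigr => i _ do rewrite linearZ /= hp scalerA.
  rewrite -scaler_suml.
  have := congr1 (fun M : 'M_1 => M 0 0) (syz_module0 z).
  by rewrite !mxE => ->; rewrite scale0r.
have [q hq] : exists q : syz_module b -> P 2%N,
    forall z, d 1%N (q z) = \sum_i syz_val z 0 i *: p i.
  have hex (z : syz_module b) : exists q, d 1%N q == \sum_i syz_val z 0 i *: p i.
    by have [w /eqP] := q_ex z; exists w.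
  by exists (fun z => xchoose (hex z)) => z; apply/eqP; exact: (xchooseP (hex z)).
have q_lin : linear q.
  move=> a x y; apply: d1inj; rewrite linearP !hq scaler_sumr -big_split /=.
  by apply: eq_bigr => i _; rewrite !mxE scalerDl scalerA.
have s_lin : linear (fun z => beta2 (q z)).
  by move=> a x y; rewrite q_lin linearP.
have [h hh] : exists h : 'rV_nu, beta0 p0 - 1 = (h *m b) 0 0.
  apply/genI/pi0; rewrite rmorphB /= rmorph1.
  have /= -> := hbeta0 p0.
  by rewrite hp0 rmorph1 subrr.
pose Y : 'M[R]_nu := \matrix_i (beta1 (p i) - delta_mx 0 i - b i 0 *: h).
exists (mk_linear s_lin), Y; split.
  apply/row_matrixP=> i; rewrite row_mul rowK row0; apply: mx11P.
  have entryB (M N L : 'M[R]_1) (x : R) :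
      (M - N - x *: L) 0 0 = M 0 0 - N 0 0 - x * L 0 0 by rewrite !mxE.
  rewrite !mulmxBl -scalemxAl -rowE entryB hbeta1 hp linearZ -hh /= mxE.
  by rewrite mulrBr mulr1 opprB addrC addrA addrNK subrr.
move=> z /=; rewrite hbeta2 /= hq linear_sum /=.
have hz := syz_module0 z.
(* the contribution of h vanishes because z is a syzygy *)
have hb0 : \sum_i syz_val z 0 i *: (b i 0 *: h) = 0.
  under eq_bigr => i _ do rewrite scalerA.
  rewrite -scaler_suml.
  have := congr1 (fun M : 'M_1 => M 0 0) hz.
  by rewrite !mxE => ->; rewrite scale0r.
rewrite [X in _ = X + _]row_sum_delta mulmx_sum_row -big_split /=.
transitivity (\sum_i z 0 i *: beta1 (p i) - \sum_i z 0 i *: (b i 0 *: h)).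
  by rewrite hb0 subr0; apply: eq_bigr => i _; rewrite linearZ.
rewrite -sumrB; apply: eq_bigr => i _; rewrite rowK -scalerDr -scalerBr.
congr (_ *: _).
by rewrite [RHS]addrC [RHS]addrAC subrK.
Qed.

End Comparison.

(** * Independence of minimal syzygies *)

HB.instance Definition _ (R : comNzRingType) (M : lmodType R) :=
  GRing.isZmodMorphism.Build {freeg M / R} M (fglift (idfun : M -> M))
    (@lift_is_additive R M M idfun).

Lemma fglift_linear (R : comNzRingType) (M : lmodType R) :
  linear (fglift (idfun : M -> M) : {freeg M / R} -> M).
Proof.
move=> a D E; rewrite raddfD; congr (_ + _).
rewrite -[D in LHS]freeg_sumE scaler_sumr raddf_sum.
rewrite -[D in RHS]freeg_sumE raddf_sum scaler_sumr.
apply: eq_bigr => x _; rewrite /= liftU.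
have -> : a *: << coeff x D *g x >> = << (a * coeff x D) *g x >>.
  apply/eqP/freeg_eqP => y; rewrite coeffZ !coeffU mulrA //.
by rewrite liftU scalerA.
Qed.

Section Irrelevant.
Variables (K : fieldType) (n : nat).
Local Notation S := {mpoly K[n]}.
Local Notation ev0 := (mcoeff (0%MM : 'X_{1..n})).
Local Notation X := (\row_(i < n) ('X_i : S)).

(** Every nonconstant monomial of p is divided by one of its variables, so that
    the quotients of a form are forms. *)
Lemma split_variables (p : S) : p@_0 = 0 ->
  exists q : 'I_n -> S, p = \sum_i 'X_i * q i /\
    forall r, p \is r.+1.-homog -> forall i, q i \is r.-homog.
Proof.
move=> p0.
pose var (m : 'X_{1..n}) : option 'I_n := [pick i | m i != 0%N].
pose q i : S := \sum_(m <- msupp p | var m == Some i) p@_m *: 'X_[m - U_(i)].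
exists q; split; last first.
  move=> r /dhomogP hp i; rewrite /q big_seq_cond; apply: rpred_sum => m.
  case/andP=> /hp /= hm; rewrite /var; case: pickP => // j jP /eqP [<-].
  apply: rpredZ; rewrite dhomogX; apply/eqP.
  have /(congr1 mdeg) : (m - U_(j) + U_(j) = m)%MM by rewrite submK // lep1mP.
  by rewrite mdegD mdeg1 hm addn1 => -[].
rewrite {1}[p]mpolyE /q.
under [RHS]eq_bigr => i _ do rewrite big_mkcond mulr_sumr.
rewrite exchange_big /= big_seq [RHS]big_seq; apply: eq_bigr => m mp.
have [i hi hm] : exists2 i, var m = Some i & m i != 0%N.
  rewrite /var; case: pickP => [i|] hi; first by exists i.
  have m0 : m = 0%MM.
    by apply/mnmP=> i; rewrite mnmE; move/negbFE/eqP: (hi i).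
  by move: mp; rewrite m0 mcoeff_msupp p0 eqxx.
rewrite (bigD1 i) //= hi eqxx -scalerAr -mpolyXD addmC submK ?lep1mP //.
rewrite big1 ?addr0 // => j /negPf ji.
by rewrite (inj_eq (@Some_inj _)) eq_sym ji mulr0.
Qed.

Lemma split_variables_mx m l (A : 'M[S]_(m, l)) : map_mx ev0 A = 0 ->
  exists Q : 'I_n -> 'M[S]_(m, l), A = \sum_i 'X_i *: Q i.
Proof.
move=> A0.
have h i j : exists q : {ffun 'I_n -> S}, A i j == \sum_k 'X_k * q k.
  have := congr1 (fun M : 'M_(m, l) => M i j) A0; rewrite !mxE.
  case/split_variables => q [-> _]; exists (finfun q).
  by apply/eqP; apply: eq_bigr => k _; rewrite ffunE.
exists (fun k => \matrix_(i, j) (xchoose (h i j)) k).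
apply/matrixP=> i j; rewrite (eqP (xchooseP (h i j))) summxE.
by apply: eq_bigr => k _; rewrite !mxE.
Qed.

Lemma variables_comb l (Q : 'I_n -> 'rV[S]_l) :
  \sum_i 'X_i *: Q i = X *m (\matrix_i Q i).
Proof.
rewrite mulmx_sum_row; apply: eq_bigr => i _.
by rewrite mxE rowK.
Qed.

(** A right inverse over K of the matrix of constant terms, multiplied with W,
    gives a matrix whose determinant has constant term 1. *)
Lemma row_free_of_ev0 m l (W : 'M[S]_(m, l)) :
  (forall c : 'rV[K]_m, c *m map_mx ev0 W = 0 -> c = 0) ->
  forall r : 'rV[S]_m, r *m W = 0 -> r = 0.
Proof.
move=> h r rW.
have /row_freeP [V hV] : row_free (map_mx ev0 W) by exact: inj_row_free.
pose A := W *m map_mx (mpolyC n (R := K)) V.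
have detA : \det A != 0.
  suff /eqP h1 : ev0 (\det A) == 1.
    by apply/eqP=> h0; move: h1; rewrite h0 mcoeff0 => /esym/eqP; rewrite oner_eq0.
  rewrite -det_map_mx map_mxM.
  have -> : map_mx ev0 (map_mx (mpolyC n (R := K)) V) = V.
    by apply/matrixP=> i j; rewrite !mxE mpolyCK.
  by rewrite hV det1.
have : r *m A *m \adj A = 0 by rewrite mulmxA rW !mul0mx.
rewrite -mulmxA mul_mx_adj mul_mx_scalar => /eqP.
by rewrite scalemx_eq0 (negPf detA) => /eqP.
Qed.

(** M Z for the module Z of syzygies of b: as M is generated by the variables, one
    syzygy for each variable suffices. *)
Definition in_MZ nu (b : 'cV[S]_nu) (v : 'rV[S]_nu) :=
  exists w : 'M[S]_(n, nu), w *m b = 0 /\ v = X *m w.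

(** By Nakayama this is the minimality of b as a system of generators. *)
Definition minimal_gens nu (b : 'cV[S]_nu) :=
  forall c : 'rV[S]_nu, c *m b = 0 -> map_mx ev0 c = 0.

Definition indep_mod_MZ nu (b : 'cV[S]_nu) m (z : 'M[S]_(m, nu)) :=
  forall c : 'rV[K]_m, in_MZ b (map_mx (mpolyC n (R := K)) c *m z) -> c = 0.

(** Take for A the free module on the set Z, with the section s up to M Z.  The
    images s z_j live in finitely many coordinates.  If a K-combination of them
    had all its coordinates in M, then mapping back to Z would put the same
    combination of the z_j in M Z, because the error term z Y of the section
    also lies there.  So the constant terms of the matrix of coordinates have
    independent rows. *)
Lemma indep_syzygies (I : idealr S) nu (b : 'cV[S]_nu) m (z : 'M[S]_(m, nu)) :
  (forall p, p \in I <-> exists c : 'rV_nu, p = (c *m b) 0 0) ->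
  proj_dim_le {ideal_quot I} 2 ->
  minimal_gens b -> z *m b = 0 -> indep_mod_MZ b z ->
  forall r : 'rV[S]_m, r *m z = 0 -> r = 0.
Proof.
move=> genI pd minb zb indz.
have gS (x : syz_module b) :
    exists a, mk_linear (@fglift_linear _ (syz_module b)) a = x.
  by exists << x >>; rewrite /= liftU scale1r.
have [s [Y [Yb sY]]] := comparison_of_resolutions genI pd gS.
have zS j : row j z \in syzygies b.
  by apply/eqP; rewrite -row_mul zb row0.
pose a j := s (Syz (zS j)).
pose L := undup (flatten [seq dom (a j) | j : 'I_m]).
have LP j x : x \notin L -> coeff x (a j) = 0.
  move=> h; apply: coeff_outdom; apply: contra h => h; rewrite mem_undup.
  by apply/flatten_mapP; exists j => //; rewrite mem_enum.
pose W : 'M[S]_(m, size L) := \matrix_(j, k) coeff (tnth (in_tuple L) k) (a j).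
have comb (r : 'rV[S]_m) : exists2 y : syz_module b,
    syz_val y = r *m z & s y = \sum_j r 0 j *: a j.
  exists (\sum_j r 0 j *: Syz (zS j)); last first.
    by rewrite linear_sum /=; apply: eq_bigr => j _; rewrite linearZ.
  rewrite linear_sum mulmx_sum_row.
  by apply: eq_bigr => j _.
suff hW (c : 'rV[K]_m) : c *m map_mx ev0 W = 0 -> c = 0.
  move=> r rz; apply: (row_free_of_ev0 hW).
  have [y yv sy] := comb r.
  have y0 : y = 0 by apply: val_inj; rewrite /= yv rz.
  apply/rowP=> k; rewrite !mxE.
  move/(congr1 (coeff (tnth (in_tuple L) k))): sy.
  rewrite y0 linear0 raddf0 raddf_sum => /esym e; apply: etrans e.
  by apply: eq_bigr => j _; rewrite /= coeffZ !mxE.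
move=> cW; apply: indz.
set r := map_mx _ c; have [y yv sy] := comb r.
pose v := r *m z.
have rv0 : map_mx ev0 v = 0 by apply: minb; rewrite -mulmxA zb mulmx0.
have [v' hv'] := split_variables_mx rv0.
have D0 (x : syz_module b) : ev0 (coeff x (s y)) = 0.
  rewrite sy raddf_sum raddf_sum /=.
  have [xL|xL] := boolP (x \in L); last first.
    by apply: big1 => j _; rewrite coeffZ LP // mulr0 raddf0.
  have := congr1 (fun M : 'rV_(size L) =>
    M 0 (Ordinal (etrans (index_mem x L) xL))) cW.
  rewrite !mxE => e; apply: etrans e; apply: eq_bigr => j _.
  rewrite /r coeffZ rmorphM /= !mxE mpolyCK (tnth_nth x) /= nth_index //.
have q_ex (x : syz_module b) : exists q : {ffun 'I_n -> S},
    coeff x (s y) == \sum_k 'X_k * q k.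
  have [q [-> _]] := split_variables (D0 x); exists (finfun q).
  by apply/eqP; apply: eq_bigr => k _; rewrite ffunE.
pose q x := xchoose (q_ex x).
have hq x : coeff x (s y) = \sum_k 'X_k * q x k.
  exact/eqP/(xchooseP (q_ex x)).
pose w i := \sum_(x <- dom (s y)) q x i *: syz_val x - v' i *m Y.
exists (\matrix_i w i); split.
  apply/row_matrixP=> i; rewrite row_mul rowK row0 mulmxBl -mulmxA Yb mulmx0.
  rewrite subr0 mulmx_suml big1 // => x _.
  by rewrite -scalemxAl syz_module0 scaler0.
rewrite -variables_comb -[LHS](addrK (v *m Y)) -yv.
have := sY y; rewrite yv -/v => <-.
rewrite {1}hv' mulmx_suml -[s y in LHS]freeg_sumE linear_sum /=.
under eq_bigr => x _ do rewrite liftU hq.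
rewrite linear_sum /=.
under eq_bigr => x _ do rewrite scaler_suml.
rewrite exchange_big -sumrB; apply: eq_bigr => i _.
rewrite /w scalerBr scaler_sumr scalemxAl; congr (_ - _).
by apply: eq_bigr => x _; rewrite scalerA.
Qed.

End Irrelevant.

(** * Clearing denominators *)

Section Frac.
Variable R : idomainType.
Local Notation F := {fraction R}.
Local Notation "x %:F" := (@FracField.tofrac R x).

Lemma tofrac_inj : injective (@FracField.tofrac R).
Proof. by move=> x y /eqP; rewrite tofrac_eq => /eqP. Qed.

Lemma frac_repr (x : F) : exists2 d : R, d != 0 & exists r, x * d%:F = r%:F.
Proof.
elim/quotW: x => x; exists (frac x).2; first exact: denom_ratioP.
exists (frac x).1.
suff : FracField.mul (\pi_(FracField.type R) x) ((frac x).2)%:F = ((frac x).1)%:F.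
  by [].
have dx := denom_ratioP x.
rewrite !piE; apply/eqmodP; rewrite /= FracField.equivfE /FracField.mulf.
by rewrite !numden_Ratio ?oner_eq0 ?mulf_neq0 ?oner_eq0 // !mulr1 mulrC.
Qed.

Lemma frac_common_denom (J : finType) (x : J -> F) :
  exists2 d : R, d != 0 & exists r : J -> R, forall j, x j * d%:F = (r j)%:F.
Proof.
have h j : exists d : R, d != 0 /\ exists r, x j * d%:F = r%:F.
  by have [d d0 [r hr]] := frac_repr (x j); exists d; split=> //; exists r.
have [d hd] := fin_all_exists h.
have h2 j : exists r, x j * (d j)%:F = r%:F by case: (hd j).
have [r hr] := fin_all_exists h2.
exists (\prod_j d j); first by apply/prodf_neq0 => j _; case: (hd j).
exists (fun j => r j * \prod_(i | i != j) d i) => j.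
by rewrite (bigD1 j) //= !rmorphM mulrA hr.
Qed.

Lemma frac_row_free m l (A : 'M[R]_(m, l)) :
  (forall r : 'rV[R]_m, r *m A = 0 -> r = 0) ->
  row_free (map_mx (@FracField.tofrac R) A).
Proof.
move=> h; apply: inj_row_free => v hv.
have [d d0 [r hr]] := frac_common_denom (v 0).
have hr' : d%:F *: v = map_mx (@FracField.tofrac R) (\row_j r j).
  by apply/rowP=> j; rewrite !mxE mulrC hr.
have : map_mx (@FracField.tofrac R) ((\row_j r j) *m A) = 0.
  by rewrite map_mxM -hr' -scalemxAl hv scaler0.
rewrite -[RHS](map_mx0 (@FracField.tofrac R)) => e.
have /h r0 : \row_j r j *m A = 0.
  apply/matrixP=> i j; apply: tofrac_inj.
  by have := congr1 (fun M : 'M_(1, l) => M i j) e; rewrite !mxE.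
apply/eqP; move: hr'; rewrite r0 map_mx0 => /eqP.
by rewrite scalemx_eq0 tofrac_eq0 (negPf d0).
Qed.

Lemma indep_rows_leq m l (A : 'M[R]_(m, l)) :
  (forall r : 'rV[R]_m, r *m A = 0 -> r = 0) -> (m <= l)%N.
Proof.
by move/frac_row_free; rewrite /row_free => /eqP <-; exact: rank_leq_col.
Qed.

(** A square matrix with independent rows is invertible over the fraction field. *)
Lemma indep_rows_kernel m l (A : 'M[R]_(m, l)) (b : 'cV[R]_l) :
  (forall r : 'rV[R]_m, r *m A = 0 -> r = 0) -> A *m b = 0 -> b != 0 ->
  (m < l)%N.
Proof.
move=> /frac_row_free; rewrite /row_free => /eqP hA Ab b0.
rewrite ltn_neqAle -{2}hA rank_leq_col andbT; apply/eqP=> ml.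
move: A b hA Ab b0; rewrite -ml => A b hA Ab b0.
have uA : map_mx (@FracField.tofrac R) A \in unitmx.
  by rewrite -row_free_unit /row_free hA.
have e : map_mx (@FracField.tofrac R) A *m map_mx (@FracField.tofrac R) b = 0.
  by rewrite -map_mxM Ab map_mx0.
have := mulKmx uA (map_mx (@FracField.tofrac R) b); rewrite e mulmx0 => /esym e2.
case/negP: b0; apply/eqP/matrixP => i j; apply: tofrac_inj.
by have := congr1 (fun M : 'M_(m, 1) => M i j) e2; rewrite !mxE tofrac0.
Qed.
End Frac.

Lemma mcoeff_pihomog (R : nzRingType) n d (p : {mpoly R[n]}) m :
  (pihomog mdeg d p)@_m = if mdeg m == d then p@_m else 0.
Proof.
case: eqP => [<-|/eqP md]; last first.
  by apply: dhomog_nemf_coeff md; exact: pihomogP.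
have lt : (mdeg m < (msize p + mdeg m).+1)%N by rewrite ltnS leq_addl.
have pE : p = \sum_(i < (msize p + mdeg m).+1) pihomog mdeg i p.
  by apply: pihomog_partitionE; rewrite leqW // leq_addr.
apply/esym; rewrite [in LHS]pE [LHS]raddf_sum /= (bigD1 (Ordinal lt)) //=.
rewrite [X in _ + X]big1 ?addr0 // => i im.
apply: (@dhomog_nemf_coeff _ _ mdeg i); first exact: pihomogP.
by apply: contra im => /eqP h; apply/eqP/val_inj.
Qed.

Lemma pihomog0E (R : nzRingType) n (p : {mpoly R[n]}) :
  pihomog mdeg 0 p = (p@_0)%:MP.
Proof.
apply/mpolyP=> m; rewrite mcoeff_pihomog mdeg_eq0 mcoeffC.
by case: eqP => [->|]; rewrite ?mulr1 ?mulr0.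
Qed.

Section Grading.
Variables (K : fieldType) (n : nat).
Local Notation S := {mpoly K[n]}.
Local Notation ev0 := (mcoeff (0%MM : 'X_{1..n})).
Local Notation X := (\row_(i < n) ('X_i : S)).

(** The part of degree e of p as an element of the shifted module S(-d), in which
    1 has degree d.  The guard is needed because e - d is truncated. *)
Definition hpart (d e : nat) (p : S) : S :=
  if (d <= e)%N then pihomog mdeg (e - d) p else 0.

Lemma hpart_linear d e : linear (hpart d e).
Proof.
move=> a p q; rewrite /hpart; case: ifP => _; first exact: linearP.
by rewrite scaler0 addr0.
Qed.
HB.instance Definition _ d e :=
  GRing.isLinear.Build K S S _ (hpart d e) (hpart_linear d e).

Lemma pihomogM d e (p q : S) : q \is d.-homog ->
  pihomog mdeg e (p * q) = hpart d e p * q.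
Proof.
move=> hq; pose k := (msize p + e).+1.
have {1}-> : p = \sum_(i < k) pihomog mdeg i p.
  by apply: pihomog_partitionE; rewrite /k leqW // leq_addr.
rewrite mulr_suml raddf_sum /hpart /=.
have step (i : 'I_k) : pihomog mdeg e (pihomog mdeg i p * q) =
    if (i + d == e)%N then pihomog mdeg i p * q else 0.
  have hi : pihomog mdeg i p * q \is (i + d).-homog.
    by apply: dhomogM => //; apply: pihomogP.
  case: eqP => [<-|/eqP ne]; first exact: pihomog_dE.
  by rewrite (pihomog_ne0 ne hi).
under eq_bigr => i _ do rewrite step.
case: leqP => [de|ed]; last first.
  rewrite mul0r big1 // => i _; case: eqP => // h.
  by move: ed; rewrite -h ltnNge leq_addl.
have lt : (e - d < k)%N by rewrite /k ltnS (leq_trans (leq_subr _ _)) // leq_addl.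
rewrite (bigD1 (Ordinal lt)) //= subnK // eqxx big1 ?addr0 // => i ne.
case: eqP => // h; case/eqP: ne; apply: val_inj => /=.
by rewrite -h addnK.
Qed.

Lemma hpartM d f e (a p : S) : hpart d f p = p ->
  hpart d e (a * p) = hpart f e a * p.
Proof.
rewrite {1}/hpart; case: leqP => [df|fd] hp; last by rewrite -hp !(mulr0, raddf0).
have ph : p \is (f - d).-homog by rewrite -hp pihomogP.
rewrite /hpart; case: leqP => [de|ed].
  rewrite (pihomogM _ _ ph) /hpart leq_sub2rE //.
  by case: ifP => // fe; rewrite subnBA // subnK.
by rewrite ifF ?mul0r //; apply/negbTE; rewrite -ltnNge (leq_trans ed).
Qed.

Lemma hpartX d e (i : 'I_n) p : hpart d e.+1 ('X_i * p) = 'X_i * hpart d e p.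
Proof.
have hX : ('X_i : S) \is 1.-homog by rewrite dhomogX /= mdeg1.
rewrite mulrC /hpart; case: leqP => [de|ed].
  rewrite (pihomogM _ _ hX) mulrC /hpart; congr (_ * _).
  move: de; rewrite leq_eqVlt ltnS => /orP[/eqP->|de].
    by rewrite subnn !ltnn.
  by rewrite de subSn // subn1.
by rewrite ifF ?mulr0 //; apply/negbTE; rewrite -ltnNge ltnW.
Qed.

Lemma hpartX0 d (i : 'I_n) p : hpart d 0 ('X_i * p) = 0.
Proof.
have hX : ('X_i : S) \is 1.-homog by rewrite dhomogX /= mdeg1.
by rewrite mulrC /hpart; case: ifP => // _; rewrite (pihomogM _ _ hX) mul0r.
Qed.

Lemma hpart_sum d p E : (d + msize p <= E)%N ->
  p = \sum_(e < E) hpart d e p.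
Proof.
move=> hE; have [k -> hk] : exists2 k, E = (d + k)%N & (msize p <= k)%N.
  exists (E - d)%N; last by rewrite leq_subRL ?(leq_trans (leq_addr _ _) hE).
  by rewrite subnKC // (leq_trans (leq_addr _ _) hE).
rewrite big_split_ord /= [X in X + _]big1 ?add0r => [|i _].
  rewrite {1}[p](pihomog_partitionE (mf := mdeg) hk).
  by apply: eq_bigr => i _; rewrite /hpart leq_addr addKn.
by rewrite /hpart leqNgt ltn_ord.
Qed.

Variables (nu : nat) (dg : 'I_nu -> nat) (b : 'cV[S]_nu).
Hypothesis bh : forall i, b i 0 \is (dg i).-homog.

(** The part of degree e of a vector of S^nu, where the i-th basis vector has
    degree dg i, as its image b i does. *)
Definition vpart e (c : 'rV[S]_nu) : 'rV[S]_nu := \row_i hpart (dg i) e (c 0 i).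

Lemma vpart_additive e : zmod_morphism (vpart e).
Proof. by move=> p q; apply/rowP=> i; rewrite !mxE raddfB. Qed.
HB.instance Definition _ e := GRing.isZmodMorphism.Build 'rV[S]_nu 'rV[S]_nu
  (vpart e) (vpart_additive e).

Lemma vpartZ f e a z : vpart f z = z -> vpart e (a *: z) = hpart f e a *: z.
Proof.
move=> /rowP hz; apply/rowP=> i; rewrite !mxE (@hpartM _ f) //.
by move: (hz i); rewrite mxE.
Qed.

Lemma vpartX e (i : 'I_n) z : vpart e.+1 ('X_i *: z) = 'X_i *: vpart e z.
Proof. by apply/rowP=> j; rewrite !mxE hpartX. Qed.

Lemma vpartX0 (i : 'I_n) z : vpart 0 ('X_i *: z) = 0.
Proof. by apply/rowP=> j; rewrite !mxE hpartX0. Qed.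

Lemma hpart_id d e p : hpart d e (hpart d e p) = hpart d e p.
Proof. by rewrite /hpart; case: leqP => // _; rewrite pihomog_id. Qed.

Lemma vpart_id e c : vpart e (vpart e c) = vpart e c.
Proof. by apply/rowP=> i; rewrite [in LHS]mxE mxE hpart_id. Qed.

Lemma vpart_mul e c : (vpart e c *m b) 0 0 = pihomog mdeg e ((c *m b) 0 0).
Proof.
rewrite !mxE raddf_sum; apply: eq_bigr => i _ /=.
by rewrite mxE (pihomogM _ _ (bh i)).
Qed.

Lemma vpart_syz e c : c *m b = 0 -> vpart e c *m b = 0.
Proof.
move=> h; apply/matrixP=> i j; rewrite !ord1 vpart_mul h !mxE.
exact: raddf0.
Qed.

Lemma vpart_sum c : exists E, c = \sum_(e < E) vpart e c.
Proof.
exists (\sum_i (dg i + msize (c 0%R i)))%N; apply/rowP=> i.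
rewrite summxE.
rewrite {1}(@hpart_sum (dg i) (c 0 i) (\sum_i (dg i + msize (c 0%R i)))%N).
  by apply: eq_bigr => e _; rewrite mxE.
by rewrite (bigD1 i) //= leq_addr.
Qed.

Definition homog_rows m (z : 'M[S]_(m, nu)) (eg : 'I_m -> nat) :=
  forall j, vpart (eg j) (row j z) = row j z.

Lemma vpart_mulmx m (z : 'M[S]_(m, nu)) eg (r : 'rV[S]_m) e : homog_rows z eg ->
  vpart e (r *m z) = (\row_j hpart (eg j) e (r 0 j)) *m z.
Proof.
move=> hz; rewrite !mulmx_sum_row raddf_sum; apply: eq_bigr => j _ /=.
by rewrite (vpartZ _ _ (hz j)) mxE.
Qed.

Section Maximal.
Variables (m : nat) (z : 'M[S]_(m, nu)) (eg : 'I_m -> nat).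
Hypotheses (hz : homog_rows z eg) (indz : indep_mod_MZ b z).
Hypothesis zmax : forall e (w : 'rV[S]_nu), w *m b = 0 -> vpart e w = w ->
  ~ indep_mod_MZ b (col_mx z w).

(** By maximality, a homogeneous syzygy w of degree e is, up to a nonzero scalar,
    a K-combination of the z_j plus an element of M Z.  Its parts of degree e
    express w through the z_j and the degree-e part of an element of M Z, which
    involves only syzygies of smaller degree. *)
Lemma homog_syz_span_step e :
  (forall y : 'M[S]_(n, nu), y *m b = 0 ->
     exists r : 'rV[S]_m, vpart e (X *m y) = r *m z) ->
  forall w, w *m b = 0 -> vpart e w = w -> exists r : 'rV[S]_m, w = r *m z.
Proof.
move=> step w wb we.
have [c [y [yb cy]] c0] : exists2 c : 'rV[K]_(m + 1),
    in_MZ b (map_mx (mpolyC n (R := K)) c *m col_mx z w) & c <> 0.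
  have := zmax wb we; rewrite /indep_mod_MZ => /not_all_ex_not [c] hc.
  by exists c; [apply: NNPP => h | move=> c0]; apply: hc.
pose g := rsubmx c 0 0.
have ceq : map_mx (mpolyC n (R := K)) c *m col_mx z w =
    map_mx (mpolyC n (R := K)) (lsubmx c) *m z + g%:MP *: w.
  rewrite -{1}[c]hsubmxK map_row_mx mul_row_col; congr (_ + _).
  apply/rowP=> i; rewrite !mxE big_ord1 !mxE /g mxE.
  by congr ((c _ _)%:MP * _).
have g0 : g != 0.
  apply/eqP=> g0; apply: c0; rewrite -[c]hsubmxK.
  have -> : rsubmx c = 0 by apply/matrixP=> i j; rewrite !ord1 -/g g0 mxE.
  rewrite (_ : lsubmx c = 0) ?row_mx0 //; apply: indz.
  by exists y; split=> //; rewrite -cy ceq g0 mpolyC0 scale0r addr0.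
have [r hr] := step y yb.
have := congr1 (vpart e) cy.
rewrite ceq raddfD /= (vpart_mulmx _ _ hz) (vpartZ _ _ we) hr /hpart leqnn subnn.
set r' := \row_j _; rewrite pihomog_dE; last first.
  by rewrite -[_%:MP]mulr1 mul_mpolyC; apply: dhomogZ; apply: dhomog1.
move=> h; exists ((g^-1)%:MP *: (r - r')).
rewrite -scalemxAl mulmxBl -h addrC addrA addNr add0r scalerA -mpolyCM.
by rewrite mulVf // mpolyC1 scale1r.
Qed.

Lemma homog_syz_span e w : w *m b = 0 -> vpart e w = w ->
  exists r : 'rV[S]_m, w = r *m z.
Proof.
elim: e w => [|e IH]; apply: homog_syz_span_step => y yb.
  exists 0; rewrite mul0mx mulmx_sum_row raddf_sum big1 // => i _ /=.
  by rewrite mxE vpartX0.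
have /fin_all_exists [r hr] (i : 'I_n) :
    exists r : 'rV[S]_m, vpart e (row i y) = r *m z.
  apply: IH; last exact: vpart_id.
  by apply: vpart_syz; rewrite -row_mul yb row0.
exists (\sum_i 'X_i *: r i); rewrite mulmx_sum_row raddf_sum mulmx_suml.
by apply: eq_bigr => i _; rewrite /= mxE vpartX hr -scalemxAl.
Qed.

Lemma syz_span w : w *m b = 0 -> exists r : 'rV[S]_m, w = r *m z.
Proof.
move=> wb; have [E ->] := vpart_sum w.
have /fin_all_exists [r hr] (e : 'I_E) :
    exists r : 'rV[S]_m, vpart e w = r *m z.
  by apply: (@homog_syz_span e); [exact: vpart_syz | exact: vpart_id].
by exists (\sum_e r e); rewrite mulmx_suml; apply: eq_bigr.
Qed.
End Maximal.

Definition free_syzygies m (z : 'M[S]_(m, nu)) :=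
  [/\ z *m b = 0, forall r : 'rV[S]_m, r *m z = 0 -> r = 0
    & forall w : 'rV[S]_nu, w *m b = 0 -> exists r : 'rV[S]_m, w = r *m z].

(** Families that are K-independent modulo M Z are independent over S, so they
    have at most nu members, and a maximal homogeneous one generates Z. *)
Theorem free_graded_syzygies (I : idealr S) :
  (forall p, p \in I <-> exists c : 'rV_nu, p = (c *m b) 0 0) ->
  proj_dim_le {ideal_quot I} 2 -> minimal_gens b ->
  exists m (z : 'M[S]_(m, nu)) eg, homog_rows z eg /\ free_syzygies z.
Proof.
move=> genI pd minb.
pose P m := exists (z : 'M[S]_(m, nu)) eg,
  [/\ homog_rows z eg, z *m b = 0 & indep_mod_MZ b z].
have free m (z : 'M[S]_(m, nu)) : z *m b = 0 -> indep_mod_MZ b z ->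
    forall r : 'rV[S]_m, r *m z = 0 -> r = 0.
  exact: indep_syzygies genI pd minb.
have P0 : P 0%N.
  exists 0, (fun=> 0%N); split; rewrite ?mul0mx //; first by case.
  by move=> c _; apply: thinmx0.
have [m Pm nP] : exists2 m, P m & ~ P m.+1.
  apply: NNPP => h.
  have PS m : P m.
    elim: m => // m Pm; apply: NNPP => nP; apply: h; by exists m.
  have [z [eg [_ zb indz]]] := PS nu.+1.
  by have := indep_rows_leq (free _ _ zb indz); rewrite ltnn.
have [z [eg [hz zb indz]]] := Pm.
exists m, z, eg; split=> //; split=> //; first exact: free.
apply: (syz_span hz indz) => e w wb we indw; apply: nP.
have : P (m + 1)%N; last by rewrite addn1.
exists (col_mx z w), (fun j => if split j is inl j then eg j else e).
split=> //; last by rewrite mul_col_mx zb wb col_mx0.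
move=> j; case: splitP => k hk.
  by rewrite (_ : j = lshift 1 k) ?rowKu //; apply: val_inj.
rewrite (_ : j = rshift m k) ?rowKd; last by apply: val_inj.
by rewrite (_ : row k w = w) //; apply/rowP=> i; rewrite mxE ord1.
Qed.

End Grading.

(** * Forms generating a power of the irrelevant ideal *)

Section Spans.
Variables (K : fieldType) (V : lmodType K).

Definition spanned (J : finType) (v : J -> V) (p : V) :=
  exists c : J -> K, p = \sum_j c j *: v j.

Lemma spanned_mem (J : finType) (v : J -> V) j : spanned v (v j).
Proof.
exists (fun i => (i == j)%:R); rewrite (bigD1 j) //= eqxx scale1r big1 ?addr0 //.
by move=> i /negPf ->; rewrite scale0r.
Qed.

Lemma spanned_comb (J T : finType) (v : J -> V) (c : T -> K) (u : T -> V) :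
  (forall i, spanned v (u i)) -> spanned v (\sum_i c i *: u i).
Proof.
move=> /fin_all_exists [f hf]; exists (fun j => \sum_i c i * f i j).
under eq_bigr => i _ do rewrite hf scaler_sumr.
rewrite exchange_big; apply: eq_bigr => j _; rewrite scaler_suml.
by apply: eq_bigr => i _; rewrite scalerA.
Qed.

Lemma spanned_sum (J : finType) (v : J -> V) (T : eqType) (s : seq T)
    (c : T -> K) (u : T -> V) :
  {in s, forall i, spanned v (u i)} -> spanned v (\sum_(i <- s) c i *: u i).
Proof.
move=> h; rewrite big_tnth; apply: (@spanned_comb _ _ _ (fun i => c _)) => i.
exact/h/mem_tnth.
Qed.

Lemma spanned_trans (J J' : finType) (v : J -> V) (v' : J' -> V) p :
  (forall j, spanned v (v' j)) -> spanned v' p -> spanned v p.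
Proof. by move=> h [c ->]; apply: spanned_comb. Qed.

(** Steinitz: the matrix of the u i in terms of v has independent rows. *)
Lemma independent_leq_spanning (I J : finType) (u : I -> V) (v : J -> V) :
  (forall x : I -> K, \sum_i x i *: u i = 0 -> forall i, x i = 0) ->
  (forall i, spanned v (u i)) -> (#|I| <= #|J|)%N.
Proof.
move=> ind /fin_all_exists [c hc].
pose C : 'M[K]_(#|I|, #|J|) := \matrix_(i, j) c (enum_val i) (enum_val j).
suff : row_free C by rewrite /row_free => /eqP <-; exact: rank_leq_col.
apply: inj_row_free => x xC; apply/rowP => i; rewrite mxE.
rewrite -(enum_valK i); apply: (ind (fun i => x 0 (enum_rank i))).
under eq_bigr => i' _ do rewrite hc scaler_sumr.
rewrite exchange_big big1 // => j _ /=.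
under eq_bigr => i' _ do rewrite scalerA.
rewrite -scaler_suml (_ : \sum_i _ = 0) ?scale0r //.
have := congr1 (fun M : 'rV_#|J| => M 0 (enum_rank j)) xC.
rewrite !mxE => e; apply: etrans e; rewrite (reindex (@enum_val I predT)) /=.
  by apply: eq_bigr => i' _; rewrite enum_valK mxE enum_rankK.
by apply: onW_bij; exact: enum_val_bij.
Qed.
End Spans.

Section Krull.
Variables (K : fieldType) (n m : nat) (a : 'I_m -> {mpoly K[n]}).
Variables (k : 'I_m -> nat) (t : nat).
Local Notation S := {mpoly K[n]}.
Hypothesis ah : forall j, a j \is (k j).-homog.
Hypothesis k0 : forall j, (0 < k j)%N.
Hypothesis forms_in : forall mu : 'X_{1..n}, (t <= mdeg mu)%N ->
  exists r : 'I_m -> S, 'X_[mu] = \sum_j r j * a j.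

(** Bounding the exponents separately makes the index set a box, whose size is
    evident. *)
Definition power_family N (x : {ffun 'I_n -> 'I_t} * {ffun 'I_m -> 'I_N}) : S :=
  'X_[ [multinom (x.1 i : nat) | i < n] ] * \prod_j a j ^+ (x.2 j).

Lemma power_family_mono N N' p : (N <= N')%N ->
  spanned (@power_family N) p -> spanned (@power_family N') p.
Proof.
move=> NN; apply: spanned_trans => x.
rewrite (_ : power_family x = power_family (x.1, [ffun j => widen_ord NN (x.2 j)])).
  exact: spanned_mem.
by rewrite /power_family; congr (_ * _); apply: eq_bigr => j _; rewrite ffunE.
Qed.

Lemma power_family_mul N p j :
  spanned (@power_family N) p -> spanned (@power_family N.+1) (p * a j).
Proof.
case=> c ->; rewrite mulr_suml.
under eq_bigr => x _ do rewrite -scalerAl.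
apply: spanned_comb => x.
have lt i : (x.2 i + (i == j) < N.+1)%N.
  rewrite ltnS; apply: leq_trans (ltn_ord (x.2 i)).
  by rewrite -addn1 leq_add2l leq_b1.
rewrite (_ : _ * _ = power_family (x.1, [ffun i => Ordinal (lt i)])).
  exact: spanned_mem.
rewrite /power_family /= -mulrA; congr (_ * _).
rewrite (bigD1 j) //= [RHS](bigD1 j) //= ffunE /= eqxx exprD expr1 -!mulrA.
congr (_ * _); rewrite mulrC; congr (_ * _).
by apply: eq_bigr => i /negPf ij; rewrite ffunE /= ij addn0.
Qed.

(** A monomial of degree e >= t is a combination of the a j whose coefficients may
    be taken homogeneous of smaller degree. *)
Lemma power_family_homog e (p : S) :
  p \is e.-homog -> spanned (@power_family e.+1) p.
Proof.
have [N] := ubnP e; elim: N e p => // N IH e p; rewrite ltnS => eN hp.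
rewrite [p]mpolyE; apply: spanned_sum => mu /(dhomog_mf hp) /= hmu.
have [te|et] := leqP t e; last first.
  have lt i : (mu i < t)%N.
    by apply: leq_ltn_trans et; rewrite -hmu mdegE (bigD1 i) //= leq_addr.
  rewrite (_ : 'X_[mu] = power_family
    ([ffun i => Ordinal (lt i)], [ffun=> (ord0 : 'I_e.+1)])).
    exact: spanned_mem.
  rewrite /power_family big1 ?mulr1 => [|j _]; last by rewrite ffunE.
  by congr 'X_[_]; apply/mnmP=> i; rewrite mnmE ffunE.
have [r hr] : exists r : 'I_m -> S, 'X_[mu] = \sum_j r j * a j.
  by apply: forms_in; rewrite hmu.
have -> : 'X_[mu] = \sum_j (1 : K) *: (hpart (k j) e (r j) * a j).
  rewrite -[LHS](@pihomog_dE _ _ mdeg e); last by rewrite dhomogX /= hmu.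
  rewrite hr raddf_sum.
  by apply: eq_bigr => j _; rewrite /= scale1r -(pihomogM _ _ (ah j)).
apply: spanned_comb => j; rewrite /hpart; case: leqP => [ke|_]; last first.
  rewrite mul0r; exists (fun=> 0); rewrite big1 // => x _; exact: scale0r.
have e0 : (0 < e)%N := leq_trans (k0 j) ke.
apply: power_family_mul.
have lt : (e - k j < e)%N by rewrite ltn_subrL k0.
apply: (@power_family_mono (e - k j).+1) => //.
apply: IH; last exact: pihomogP.
exact: leq_trans eN.
Qed.

(** The D ^ n monomials with exponents below D have degree at most n D, so they
    lie in the span of the power_family with N = n D + 1. *)
Lemma krull_bound D : (D ^ n <= t ^ n * (n * D).+1 ^ m)%N.
Proof.
pose u (x : {ffun 'I_n -> 'I_D}) : S := 'X_[ [multinom (x i : nat) | i < n] ].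
have := @independent_leq_spanning _ _ _ _ u (@power_family (n * D).+1).
rewrite card_prod !card_ffun !card_ord; apply.
  move=> c h x; move/(congr1 (mcoeff [multinom (x i : nat) | i < n])): h.
  rewrite raddf_sum (bigD1 x) //= mcoeffZ mcoeffX eqxx mulr1 raddf0.
  rewrite big1 ?addr0 // => y yx; rewrite mcoeffZ mcoeffX.
  case: eqP => [/mnmP h|]; last by rewrite mulr0.
  case/eqP: yx; apply/ffunP=> i; apply: val_inj.
  by have := h i; rewrite !mnmE.
move=> x; pose mu := [multinom (x i : nat) | i < n]; rewrite /u -/mu.
apply: (@power_family_mono (mdeg mu).+1); last first.
  by apply: power_family_homog; rewrite dhomogX.
rewrite ltnS mdegE (leq_trans (leq_sum _ (E2 := fun=> D) _)) //.
  by move=> i _; rewrite mnmE ltnW.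
by rewrite sum_nat_const card_ord.
Qed.

(** Otherwise the left side of krull_bound would be of larger order in D than the
    right side; C is the constant of the comparison. *)
Theorem krull_height_bound : (n <= m)%N.
Proof.
rewrite leqNgt; apply/negP=> mn.
pose C := (t ^ n * n.+1 ^ m)%N.
have := krull_bound C.+1; apply/negP; rewrite -ltnNge.
have leq_exp (x y e : nat) : (x <= y)%N -> (x ^ e <= y ^ e)%N.
  by move=> xy; elim: e => // e IHe; rewrite !expnS leq_mul.
have h1 : ((n * C.+1).+1 ^ m <= n.+1 ^ m * C.+1 ^ m)%N.
  by rewrite -expnMn; apply: leq_exp; rewrite mulSn addSn ltnS leq_addl.
apply: (leq_ltn_trans (leq_mul (leqnn _) h1)); rewrite mulnA -/C.
apply: (@leq_trans (C.+1 ^ m.+1)); last by rewrite leq_pexp2l.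
by rewrite expnS ltn_mul2r expn_gt0 /=.
Qed.
End Krull.

(** * The Hilbert-Burch theorem over a principal ideal domain *)

Section HilbertBurchPID.
Variables (F : fieldType) (m : nat).
Variables (b : 'cV[{poly F}]_(m.+1)) (z : 'M[{poly F}]_(m, m.+1)).
Hypothesis b0 : b != 0.
Hypothesis zb : z *m b = 0.
Hypothesis zspan :
  forall w : 'rV_(m.+1), w *m b = 0 -> exists r : 'rV_m, w = r *m z.

Lemma bezout_family : exists u : 'rV_(m.+1), forall i, ((u *m b) 0 0 %| b i 0)%R.
Proof.
have [u hu] : exists u : 'rV[{poly F}]_(m.+1),
    {in enum 'I_(m.+1), forall i, ((u *m b) 0 0 %| b i 0)}.
  elim: (enum _) => [|i s [u IH]]; first by exists 0.
  have [v hv] := Bezoutp ((u *m b) 0 0) (b i 0).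
  exists (v.1 *: u + v.2 *: delta_mx 0 i) => j.
  have -> : ((v.1 *: u + v.2 *: delta_mx 0 i) *m b) 0 0 =
      v.1 * (u *m b) 0 0 + v.2 * b i 0.
    have entryD (M N : 'M[{poly F}]_1) x y :
        (x *: M + y *: N) 0 0 = x * M 0 0 + y * N 0 0 by rewrite !mxE.
    by rewrite mulmxDl -!scalemxAl -rowE entryD [row i b _ _]mxE.
  rewrite (eqp_dvdl _ hv) inE => /predU1P [->|/IH h]; first exact: dvdp_gcdr.
  by apply: dvdp_trans h; exact: dvdp_gcdl.
by exists u => i; apply: hu; rewrite mem_enum.
Qed.

(** Let g = u b be a generator of the ideal of the b i, and b = g b'.  Every w
    equals (w b') u plus a syzygy, so u and the rows of z span the whole space:
    T, with rows u and z, is invertible and maps b' to the first unit vector.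
    By Cramer's rule b' i is a unit times the cofactor of T at (0, i), which is
    the minor of z without column i. *)
Theorem hilbert_burch_pid : exists2 g : {poly F}, g != 0 &
  forall i, exists2 c : F, c != 0 & b i 0 = g * (c *: \det (col' i z)).
Proof.
have [u hu] := bezout_family; pose g := (u *m b) 0 0.
have g0 : g != 0.
  apply: contraNneq b0 => g0; apply/eqP/matrixP => i j; rewrite ord1 mxE.
  by have := hu i; rewrite -/g g0 dvd0p => /eqP.
pose b' : 'cV[{poly F}]_(m.+1) := \col_i (b i 0 %/ g).
have bb' : b = g *: b'.
  by apply/matrixP=> i j; rewrite !mxE ord1 mulrC divpK.
have gI k l (M : 'M[{poly F}]_(k, l)) : g *: M = 0 -> M = 0.
  by move/eqP; rewrite scalemx_eq0 (negPf g0) => /eqP.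
have zb' : z *m b' = 0 by apply: gI; rewrite scalemxAr -bb'.
have ub' : u *m b' = 1%:M.
  apply/eqP; rewrite -subr_eq0; apply/eqP/gI; rewrite scalerBr scalemxAr -bb'.
  by apply/matrixP=> i j; rewrite !ord1 !mxE eqxx mulr1 -/g /g mxE subrr.
pose T : 'M[{poly F}]_(1 + m) := col_mx u z.
have /fin_all_exists [r hr] (i : 'I_(1 + m)) : exists r : 'rV_m,
    delta_mx 0 i - b' i 0 *: u = r *m z.
  apply: zspan; rewrite bb' -scalemxAr mulmxBl -scalemxAl ub' -rowE.
  by apply/matrixP=> j k; rewrite !mxE !ord1 eqxx mulr1 subrr mulr0.
pose V : 'M[{poly F}]_(1 + m) := \matrix_i row_mx (b' i 0)%:M (r i).
have VT : V *m T = 1%:M.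
  apply/row_matrixP=> i; rewrite row_mul rowK mul_row_col -hr mul_scalar_mx.
  by rewrite addrC subrK row1.
have : \det T \is a GRing.unit.
  have := congr1 determinant VT; rewrite det_mulmx det1 => h.
  by apply/unitrPr; exists (\det V); rewrite mulrC.
rewrite poly_unitE => /andP[/eqP sT]; rewrite unitfE.
have := size1_polyC (eq_leq sT); set c := (\det T)`_0 => dT c0.
exists g => // i; exists (c^-1 * (-1) ^+ i).
  by rewrite mulf_neq0 ?invr_eq0 // signr_eq0.
have Tb' : T *m b' = col_mx 1%:M 0 by rewrite mul_col_mx ub' zb'.
have := congr1 (fun M : 'cV_(1 + m) => (\adj T *m M) i 0) Tb'.
rewrite mulmxA mul_adj_mx mul_scalar_mx mxE.
have -> : (\adj T *m col_mx 1%:M 0) i 0 = cofactor T 0 i.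
  rewrite mxE (bigD1 ord0) //= big1 ?addr0 => [|k k0].
    have := col_mxEu (1%:M : 'M[{poly F}]_1) (0 : 'M_(m, 1)) 0 0.
    rewrite (_ : lshift m 0 = ord0) => [->|]; last exact: val_inj.
    by rewrite !mxE eqxx mulr1.
  rewrite (_ : col_mx _ _ _ _ = 0) ?mulr0 //.
  case: (unliftP ord0 k) => [k' hk'|hk']; last by rewrite hk' eqxx in k0.
  rewrite (_ : k = rshift 1 k') ?col_mxEd ?mxE //; apply: val_inj.
  by rewrite hk'.
rewrite /cofactor (_ : row' 0 (col' i T) = col' i z); last first.
  apply/matrixP=> j k; rewrite [LHS]mxE [LHS]mxE [RHS]mxE.
  by rewrite -(col_mxEd u z j (fintype.lift i k)); congr (T _ _); apply: val_inj.
rewrite dT add0n => h.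
have {}h : b' i 0 = (c^-1 * (-1) ^+ i) *: \det (col' i z).
  rewrite -scalerA [X in c^-1 *: X](_ : _ = c%:P * b' i 0); last first.
    by rewrite h -mul_polyC rmorphXn /= rmorphN rmorph1.
  by rewrite mul_polyC scalerA mulVf // scale1r.
by rewrite bb' mxE h.
Qed.
End HilbertBurchPID.

(** * Restriction to a generic line *)

Lemma mpoly_rmorph_eq (K : comNzRingType) n (A : comNzRingType)
    (f g : {rmorphism {mpoly K[n]} -> A}) :
  (forall c, f c%:MP = g c%:MP) -> (forall i, f 'X_i = g 'X_i) -> f =1 g.
Proof.
move=> fgC fgX p; rewrite [p]mpolyE !rmorph_sum; apply: eq_bigr => m _ /=.
rewrite -mul_mpolyC !rmorphM /= fgC; congr (_ * _).
rewrite mpolyXE_id !rmorph_prod; apply: eq_bigr => i _.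
by rewrite !rmorphXn /= fgX.
Qed.

Section Line.
Variables (K : fieldType) (n : nat) (q : 'I_n.+1 -> K).
Local Notation S := {mpoly K[n.+1]}.
Local Notation S' := {mpoly K[n]}.
Hypothesis q0 : q ord_max != 0.

(** Substituting X_i + q_i t for X_i when i < n, and q_n t for X_n, identifies
    K[X_0, ..., X_n] with K[X_0, ..., X_(n-1)][t]: these are linear coordinates
    in which q spans the t-axis. *)
Definition line_var (i : 'I_n.+1) : {poly S'} :=
  (if unlift ord_max i is Some j then ('X_j)%:P else 0) + (q i)%:MP *: 'X.

Definition line : S -> {poly S'} := mmap (polyC \o @mpolyC n K) line_var.
HB.instance Definition _ := GRing.RMorphism.on line.

(** The inverse substitution; t comes from X_n / q_n. *)
Definition base_var (j : 'I_n) : S :=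
  'X_(fintype.lift ord_max j) -
  (q (fintype.lift ord_max j) / q ord_max) *: 'X_ord_max.
Definition base : S' -> S := mmap (@mpolyC n.+1 K) base_var.
HB.instance Definition _ := GRing.RMorphism.on base.

Definition unline : {poly S'} -> S :=
  horner_eval ((q ord_max)^-1 *: 'X_ord_max) \o map_poly base.
HB.instance Definition _ := GRing.RMorphism.copy unline
  (horner_eval ((q ord_max)^-1 *: 'X_ord_max) \o map_poly base).

Lemma lineC c : line c%:MP = (c%:MP)%:P.
Proof. by rewrite /line mmapC. Qed.
Lemma lineX i : line 'X_i = line_var i.
Proof. by rewrite /line mmapX mmap1U. Qed.
Lemma lineZ c p : line (c *: p) = c%:MP *: line p.
Proof. by rewrite -mul_mpolyC rmorphM /= lineC mul_polyC. Qed.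
Lemma baseC c : base c%:MP = c%:MP.
Proof. by rewrite /base mmapC. Qed.
Lemma baseX i : base 'X_i = base_var i.
Proof. by rewrite /base mmapX mmap1U. Qed.
Lemma unlineC c : unline c%:P = base c.
Proof. by rewrite /unline /= /horner_eval map_polyC hornerC. Qed.
Lemma unlineX : unline 'X = (q ord_max)^-1 *: 'X_ord_max.
Proof. by rewrite /unline /= /horner_eval map_polyX hornerX. Qed.

Lemma line_max : line ((q ord_max)^-1 *: 'X_ord_max) = 'X.
Proof.
rewrite lineZ lineX /line_var unlift_none add0r scalerA -mpolyCM mulVf //.
by rewrite mpolyC1 scale1r.
Qed.

Lemma lineK : cancel line unline.
Proof.
move=> p; rewrite -[RHS]/(idfun p).
apply: (@mpoly_rmorph_eq _ _ _ (unline \o line) idfun) => [c|i] /=.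
  by rewrite lineC unlineC baseC.
rewrite lineX /line_var rmorphD /= -mul_polyC rmorphM /= unlineC baseC unlineX.
rewrite mul_mpolyC scalerA.
case: unliftP => [j ->|->]; last by rewrite rmorph0 add0r mulfV // scale1r.
by rewrite unlineC baseX /base_var subrK.
Qed.

Lemma unlineK : cancel unline line.
Proof.
have lb c : line (base c) = c%:P.
  apply: (@mpoly_rmorph_eq _ _ _ (line \o base) (@polyC S')) => [a|j] /=.
    by rewrite baseC lineC.
  rewrite baseX /base_var rmorphB /= -scalerA lineZ line_max lineX.
  by rewrite /line_var liftK addrK.
move=> P; rewrite -[P in LHS]coefK poly_def 2!rmorph_sum -[RHS]coefK poly_def.
apply: eq_bigr => i _ /=.
by rewrite -mul_polyC 2!rmorphM 2!rmorphXn /= unlineX line_max unlineC lb.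
Qed.

Definition top_at (a : nat) (c : S') (P : {poly S'}) :=
  (size P <= a.+1)%N /\ P`_a = c.

Lemma top_atM a a' c c' P P' : top_at a c P -> top_at a' c' P' ->
  top_at (a + a') (c * c') (P * P').
Proof.
move=> [sP <-] [sP' <-]; split.
  apply: leq_trans (size_polyMleq _ _) _.
  have -> : (a + a').+1 = (a.+1 + a'.+1).-1 by rewrite addnS.
  by rewrite -!subn1 leq_sub2r // leq_add.
have lt : (a < (a + a').+1)%N by rewrite ltnS leq_addr.
rewrite coefM (bigD1 (Ordinal lt)) //= addKn big1 ?addr0 // => j ja.
have [jlt|jgt] := ltnP j a; last first.
  rewrite [P`_j]nth_default ?mul0r // (leq_trans sP) // ltn_neqAle jgt andbT.
  by apply: contra ja => /eqP e; apply/eqP/val_inj.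
rewrite [P'`__]nth_default ?mulr0 // (leq_trans sP') //.
by rewrite ltn_subRL ltn_add2r.
Qed.

(** The coefficient of t ^ D in a form of degree D is its value at q, the point
    where the t-axis meets the hyperplane at infinity. *)
Lemma line_top D p : p \is D.-homog -> top_at D (p.@[q])%:MP (line p).
Proof.
move=> hp.
have hX m : top_at (mdeg m) ('X_[m].@[q])%:MP (line 'X_[m]).
  rewrite /line mmapX mevalX mdegE /mmap1 rmorph_prod /=.
  elim/big_rec3: _ => [|i d c P _ h].
    by split; rewrite ?size_poly1 // coefC.
  apply: top_atM h; elim: (m i) => [|k IH].
    by split; rewrite ?expr0 ?size_poly1 // coefC.
  rewrite -addn1 addnC !exprD !expr1 rmorphM; apply: top_atM IH.
  rewrite /line_var; split.
    apply: leq_trans (size_polyD _ _) _; rewrite geq_max.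
    rewrite (leq_trans (size_scale_leq _ _)) ?size_polyX // andbT.
    case: (unlift ord_max i) => [j|]; last by rewrite size_poly0.
    exact: leq_trans (size_polyC_leq1 _) _.
  rewrite coefD coefZ coefX eqxx mulr1.
  rewrite [X in X + _](_ : _ = 0) ?add0r //.
  by case: (unlift ord_max i) => [j|]; [rewrite coefC | rewrite coef0].
have lE : line p = \sum_(m <- msupp p) (p@_m)%:MP *: line 'X_[m].
  by rewrite {1}[p]mpolyE rmorph_sum; apply: eq_bigr => m _; rewrite /= lineZ.
have eE : p.@[q] = \sum_(m <- msupp p) p@_m * ('X_[m] : S).@[q].
  by rewrite {1}[p]mpolyE raddf_sum; apply: eq_bigr => m _; rewrite /= mevalZ.
split; rewrite lE.
  apply: leq_trans (size_sum _ _ _) _; apply/bigmax_leqP_seq => m mp _.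
  rewrite (leq_trans (size_scale_leq _ _)) //.
  by rewrite -(dhomog_mf hp mp) /=; case: (hX m).
rewrite coef_sum eE raddf_sum big_seq [RHS]big_seq.
apply: eq_bigr => m mp; rewrite coefZ /= mpolyCM; congr (_ * _).
by rewrite -(dhomog_mf hp mp) /=; case: (hX m).
Qed.

Local Notation F := {fraction S'}.
Local Notation tofrac := (@FracField.tofrac S').

Definition line_frac : S -> {poly F} := map_poly tofrac \o line.
HB.instance Definition _ :=
  GRing.RMorphism.copy line_frac (map_poly tofrac \o line).

Lemma line_frac_inj : injective line_frac.
Proof.
move=> x y /map_inj_poly h; apply: (can_inj lineK); apply: h.
  exact: tofrac_inj.
exact: rmorph0.
Qed.

Lemma line_frac_size D p :
  p \is D.-homog -> p.@[q] != 0 -> size (line_frac p) = D.+1.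
Proof.
move=> hp p0; have [s t] := line_top hp.
rewrite size_map_inj_poly ?rmorph0 //; last exact: tofrac_inj.
apply/eqP; rewrite eqn_leq s /= ltnNge; apply/negP => h.
by move: t; rewrite nth_default // => /esym/eqP; rewrite mpolyC_eq0 (negPf p0).
Qed.

(** A common denominator of all coefficients; unline turns the resulting
    polynomials with coefficients in S' back into elements of S. *)
Lemma line_frac_denom (J : finType) (x : J -> {poly F}) :
  exists s : S, exists2 d : F, d != 0 & line_frac s = d%:P /\
    exists y : J -> S, forall j, line_frac s * x j = line_frac (y j).
Proof.
pose N := (\max_j size (x j))%N.
have [d d0 [r hr]] := frac_common_denom (fun k : J * 'I_N => (x k.1)`_k.2).
exists (unline d%:P); exists (tofrac d); first by rewrite tofrac_eq0.
have e : line_frac (unline d%:P) = (tofrac d)%:P.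
  by rewrite /line_frac /= unlineK map_polyC.
split=> //; exists (fun j => unline
  (\poly_(k < N) (if insub k is Some k' then r (j, k') else 0))).
move=> j; rewrite e /line_frac /= unlineK; apply/polyP => k.
rewrite coefCM coef_map coef_poly /=.
case: ltnP => [kN|Nk].
  by rewrite insubT /= -hr mulrC.
rewrite nth_default ?mulr0 ?rmorph0 // (leq_trans _ Nk) //.
exact: (leq_bigmax (F := fun j => size (x j))).
Qed.
End Line.

Section NonVanishing.
Variable K : closedFieldType.

(** Induction on the number of variables: the isomorphism line for the point
    (0, ..., 0, 1) makes h a univariate polynomial in the last variable; choose
    the other coordinates so that its leading coefficient survives. *)
Lemma exists_nonvanishing n (h : {mpoly K[n]}) : h != 0 -> exists q, h.@[q] != 0.
Proof.
elim: n h => [|n IH] h h0.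
  exists (fun=> 0); rewrite (nvar0_mpolyC h) mevalC.
  by apply: contraNneq h0 => e; rewrite (nvar0_mpolyC h) e.
pose e i : K := (i == ord_max :> 'I_n.+1)%:R.
have e0 : e ord_max != 0 by rewrite /e eqxx oner_eq0.
have l0 : line e h != 0.
  by apply: contraNneq h0 => l0; rewrite -(lineK e0 h) l0 rmorph0.
have c0 : lead_coef (line e h) != 0 by rewrite lead_coef_eq0.
have [q hq] := IH _ c0.
pose ev := (meval q : {rmorphism {mpoly K[n]} -> K}).
have m0 : map_poly ev (line e h) != 0.
  apply: contraNneq hq => m0.
  by rewrite -[_.@[q]]/(ev _) lead_coefE -coef_map m0 coef0.
have /closed_nonrootP [t ht] := m0.
pose q' i := if unlift ord_max i is Some j then q j else t.
exists q'.
have <- : (map_poly ev (line e h)).[t] = h.@[q'].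
  apply: (@mpoly_rmorph_eq _ _ _
    (horner_eval t \o map_poly ev \o line e) (meval q')).
    by move=> c; rewrite /= lineC map_polyC /horner_eval hornerC /= !mevalC.
  move=> i; rewrite /= lineX /line_var /horner_eval mevalXU rmorphD /= hornerD.
  rewrite -mul_polyC rmorphM /= map_polyX map_polyC /= mevalC.
  rewrite hornerM hornerC hornerX.
  rewrite /q' /e; case: unliftP => [j ->|->].
    rewrite map_polyC hornerC /= mevalXU eq_sym (negPf (neq_lift _ _)) mul0r addr0.
    by [].
  by rewrite rmorph0 horner0 eqxx mul1r add0r.
exact: ht.
Qed.
(** Take phi = line_frac q for a point q at which h does not vanish; then no
    divisor p of h vanishes at q, so that a form p keeps its degree in t.  The
    factor 'X_ord_max in the proof makes the last coordinate of q nonzero. *)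
Theorem generic_line n (h : {mpoly K[n.+1]}) : h != 0 ->
  exists (F : fieldType) (phi : {rmorphism {mpoly K[n.+1]} -> {poly F}}),
  [/\ injective phi,
      forall (J : finType) (x : J -> {poly F}),
        exists s, exists2 d : F, d != 0 & phi s = d%:P /\
        exists y : J -> {mpoly K[n.+1]}, forall j, phi s * x j = phi (y j)
    & forall D p r, p \is D.-homog -> h = p * r -> size (phi p) = D.+1].
Proof.
move=> h0; have Xh0 : h * 'X_ord_max != 0.
  by rewrite mulf_neq0 // -msize_poly_eq0 msizeX.
have [q] := exists_nonvanishing Xh0.
rewrite mevalM mulf_eq0 negb_or mevalXU => /andP[hq q0].
exists {fraction {mpoly K[n]}}, (line_frac q); split.
- exact: line_frac_inj.
- exact: line_frac_denom.
move=> D p r hp hE; apply: line_frac_size => //.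
by move: hq; rewrite hE mevalM mulf_eq0 negb_or => /andP[].
Qed.
End NonVanishing.

(** * Primes of height one *)

Lemma irreducible_divisor (F : fieldType) (g : {poly F}) : (1 < size g)%N ->
  exists2 p, irreducible_poly p & (p %| g)%R.
Proof.
have [N] := ubnP (size g); elim: N g => // N IH g; rewrite ltnS => gN g1.
have [irr|nirr] := classic (irreducible_poly g); first by exists g.
have [p [p1 pg npg]] : exists p : {poly F},
    [/\ size p != 1%N, (p %| g)%R & ~~ (p %= g)%R].
  apply: NNPP => h; apply: nirr; split=> // p p1 pg; apply/negPn/negP => npg.
  by apply: h; exists p.
have g0 : g != 0 by rewrite -size_poly_gt0 ltnW.
have p0 : p != 0 by apply: contraNneq g0 => p0; rewrite -dvd0p -p0.
have ltpg : (size p < size g)%N.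
  by rewrite ltn_neqAle dvdp_leq // andbT; apply: contra npg; rewrite dvdp_size_eqp.
have [||r irr rp] := IH p.
- exact: leq_trans ltpg gN.
- by move: p0 p1; rewrite -size_poly_gt0; case: (size p) => [|[|]].
by exists r => //; exact: dvdp_trans pg.
Qed.

Lemma irreducible_prime (F : fieldType) (p a c : {poly F}) : irreducible_poly p ->
  (p %| a * c -> (p %| a) || (p %| c))%R.
Proof.
move=> irr h; have [//|na /=] := boolP (p %| a)%R.
rewrite Gauss_dvdpr // in h.
rewrite coprimep_def; apply: contraR na => s1.
have := irr _ s1 (dvdp_gcdl p a); rewrite /eqp => /andP[_ /dvdp_trans].
by apply; exact: dvdp_gcdr.
Qed.

Section ZeroIdeal.
Variable S : idomainType.
Definition zero_ideal : {pred S} := fun x => x == 0.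
Lemma zero_ideal_closed : idealr_closed zero_ideal.
Proof.
rewrite /idealr_closed /in_mem /= /zero_ideal; split; rewrite ?oner_eq0 //.
by move=> a u v /eqP -> /eqP ->; rewrite mulr0 addr0.
Qed.
HB.instance Definition _ := isIdealr.Build S zero_ideal zero_ideal_closed.
Lemma zero_ideal_prime : prime_idealr_closed zero_ideal.
Proof. by move=> u v; rewrite /in_mem /= /zero_ideal mulf_eq0. Qed.
HB.instance Definition _ := isPrimeIdealrClosed.Build S zero_ideal zero_ideal_prime.
End ZeroIdeal.

Section HeightOne.
Variables (S : idomainType) (F : fieldType) (phi : {rmorphism S -> {poly F}}).
Variable pi : {poly F}.
Hypothesis pi_irr : irreducible_poly pi.

Definition contraction : {pred S} := fun x => (pi %| phi x)%R.

Lemma contraction_closed : idealr_closed contraction.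
Proof.
rewrite /idealr_closed /in_mem /= /contraction; split.
- by rewrite rmorph0 dvdp0.
- by rewrite rmorph1 dvdp1; case: pi_irr; case: (size pi) => [|[|]].
by move=> a u v hu hv; rewrite rmorphD rmorphM dvdp_add ?dvdp_mull.
Qed.
HB.instance Definition _ := isIdealr.Build S contraction contraction_closed.
Lemma contraction_prime : prime_idealr_closed contraction.
Proof.
move=> u v; rewrite /in_mem /= /contraction rmorphM.
exact: irreducible_prime.
Qed.
HB.instance Definition _ :=
  isPrimeIdealrClosed.Build S contraction contraction_prime.
Definition contraction_ideal : prime_idealr S := contraction.

Hypothesis phi_inj : injective phi.
Hypothesis phi_denom : forall (J : finType) (x : J -> {poly F}),
  exists s : S, exists2 d : F, d != 0 & phi s = d%:P /\
    exists y : J -> S, forall j, phi s * x j = phi (y j).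

Lemma contraction_const s d : phi s = d%:P -> d != 0 -> s \notin contraction_ideal.
Proof.
move=> hs d0; apply/negP; rewrite /in_mem /= /contraction hs => h.
have := dvdp_leq _ h; rewrite polyC_eq0 size_polyC d0 => /(_ isT).
by rewrite leqNgt; case: pi_irr => ->.
Qed.

(** A nonzero prime Q inside the contraction P of (pi) is P itself.  For h in Q,
    write phi h = w pi and clear denominators: Q contains one of the
    resulting elements w', p'.  In the first case w' has smaller degree than h
    and the argument is repeated; in the second case Q contains all multiples
    of p', and a multiple of each x in P by an element outside P is one. *)
Lemma contraction_minimal (Q : prime_idealr S) h :
  {subset Q <= contraction_ideal} -> h \in Q -> h != 0 ->
  {subset contraction_ideal <= Q}.
Proof.
move=> QP; have [N] := ubnP (size (phi h)).
elim: N h => // N IH h; rewrite ltnS => hN hQ h0.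
have /dvdpP [w hw] : (pi %| phi h)%R by exact: QP.
have [s [d d0 [hs [y hy]]]] := phi_denom (fun i : bool => if i then pi else w).
have := hy true; have := hy false => /=.
set p' := y true; set w' := y false => yw yp.
have sQ : s \notin Q by apply: contra (contraction_const hs d0); exact: QP.
have : w' * p' \in Q.
  rewrite (_ : w' * p' = s * s * h); first by rewrite idealMr.
  by apply: phi_inj; rewrite !rmorphM /= -yw -yp hw mulrACA.
have w0 : w != 0.
  apply: contraNneq h0 => w0; apply/eqP/phi_inj.
  by rewrite hw w0 mul0r rmorph0.
have pi0 : pi != 0 := irredp_neq0 pi_irr.
rewrite prime_idealrM => /orP [w'Q|p'Q].
  apply: (IH w') => //; last first.
    apply/eqP=> w'0; move: yw; rewrite w'0 rmorph0 hs => /eqP.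
    by rewrite mulf_eq0 polyC_eq0 (negPf d0) (negPf w0).
  rewrite -yw hs mul_polyC size_scale // (leq_trans _ hN) // hw.
  rewrite size_mul //; case: pi_irr; case: (size pi) => [|[|k]] // _ _.
  by rewrite !addnS /= ltnS leq_addr.
move=> x /dvdpP [v hv].
have [s2 [d2 d20 [hs2 [y2 hy2]]]] := phi_denom (fun i : unit => v).
have s2Q : s2 \notin Q by apply: contra (contraction_const hs2 d20); exact: QP.
have : s * s2 * x \in Q.
  rewrite (_ : s * s2 * x = y2 tt * p'); first by rewrite idealMr.
  by apply: phi_inj; rewrite !rmorphM /= -yp -hy2 hv [RHS]mulrACA [phi s2 * _]mulrC.
by rewrite !prime_idealrM (negPf sQ) (negPf s2Q).
Qed.

(** A chain with three members would have a nonzero prime strictly inside. *)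
Lemma contraction_height (x : S) : x != 0 -> x \in contraction_ideal ->
  prime_height contraction_ideal 1.
Proof.
move=> x0 xP; split.
  exists (fun i => if i is 0%N then (@zero_ideal S : prime_idealr S)
                   else contraction_ideal).
  split=> // -[|//] _; split=> [y|h].
    by move/eqP->; exact: idealr0.
  by have := h _ xP; rewrite /in_mem /= /zero_ideal (negPf x0).
move=> k [Q [Qk Qs]]; rewrite leqNgt; apply/negP=> k1.
have [k' kE] : exists k', k = k'.+2.
  by case: k k1 {Qk Qs} => [|[|k']] // _; exists k'.
subst k.
have [_ n1] := Qs k' (leqnSn _).
have [s2 n2] := Qs k'.+1 (leqnn _).
have [h hQ hn] : exists2 h, h \in Q k'.+1 & h \notin Q k'.
  apply: NNPP => hh; apply: n1 => h hQ; apply/negPn/negP => hn.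
  by apply: hh; exists h.
have h0 : h != 0 by apply: contraNneq hn => ->; exact: idealr0.
apply: n2 => y; rewrite Qk; apply: (contraction_minimal (h := h)) => //.
by move=> w /s2; rewrite Qk.
Qed.
End HeightOne.

(** * Degrees of the generators and of their relations *)

(** The vectors b_0 e_i - b_i e_0 for i > 0 are nu independent syzygies, which
    bounds m from below; the rows of z are annihilated by b, which bounds m from
    above. *)
Lemma syzygies_row_number (R : idomainType) nu (b : 'cV[R]_nu.+1) m
    (z : 'M[R]_(m, nu.+1)) :
  b 0 0 != 0 -> z *m b = 0 ->
  (forall r : 'rV[R]_m, r *m z = 0 -> r = 0) ->
  (forall w : 'rV[R]_nu.+1, w *m b = 0 -> exists r : 'rV[R]_m, w = r *m z) ->
  m = nu.
Proof.
move=> b0 zb zfree zspan; apply/eqP; rewrite eqn_leq -ltnS; apply/andP; split.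
  apply: (indep_rows_kernel zfree zb).
  by apply: contraNneq b0 => ->; rewrite mxE.
pose w (j : 'I_nu) : 'rV[R]_nu.+1 :=
  b 0 0 *: delta_mx 0 (fintype.lift 0 j) - b (fintype.lift 0 j) 0 *: delta_mx 0 0.
have /fin_all_exists [r hr] (j : 'I_nu) : exists r : 'rV[R]_m, w j = r *m z.
  apply: zspan; rewrite mulmxBl -!scalemxAl -!rowE.
  by apply/matrixP=> i k; rewrite !mxE !ord1 mulrC subrr.
apply: (@indep_rows_leq _ _ _ (\matrix_j r j)) => v vr.
have vw : \sum_j v 0 j *: w j = 0.
  under eq_bigr => j _ do rewrite hr scalemxAl.
  have e : \sum_j v 0 j *: r j = 0.
    by rewrite -[RHS]vr mulmx_sum_row; apply: eq_bigr => j _; rewrite rowK.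
  by rewrite -mulmx_suml e mul0mx.
apply/rowP=> j; rewrite mxE; apply/eqP.
have := congr1 (fun u : 'rV_nu.+1 => u 0 (fintype.lift 0 j)) vw.
rewrite summxE (bigD1 j) //= big1 ?addr0 => [|i ij].
  rewrite !mxE !eqxx /= mulr1 mulr0 subr0 => /eqP.
  by rewrite mulf_eq0 (negPf b0) orbF.
rewrite !mxE !eqxx /= mulr0 subr0 (inj_eq (@lift_inj _ _)) eq_sym (negPf ij).
by rewrite !mulr0.
Qed.

Section HilbertBurchFlat.
Variables (S : idomainType) (F : fieldType) (phi : {rmorphism S -> {poly F}}).
Hypothesis phi_inj : injective phi.
Hypothesis phi_denom : forall (J : finType) (x : J -> {poly F}),
  exists s : S, exists2 d : F, d != 0 & phi s = d%:P /\
    exists y : J -> S, forall j, phi s * x j = phi (y j).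
Variables (m : nat) (b : 'cV[S]_m.+1) (z : 'M[S]_(m, m.+1)).
Hypothesis b0 : b 0 0 != 0.
Hypothesis zb : z *m b = 0.
Hypothesis zspan :
  forall w : 'rV[S]_m.+1, w *m b = 0 -> exists r : 'rV[S]_m, w = r *m z.

(** Clearing denominators, the rows of phi z still span the syzygies of phi b, so
    hilbert_burch_pid applies. *)
Lemma hilbert_burch_flat : exists2 g : {poly F}, g != 0 &
  forall i, exists2 c : F, c != 0 & phi (b i 0) = g * (c *: phi (\det (col' i z))).
Proof.
pose bF := map_mx phi b; pose zF := map_mx phi z.
have bF0 : bF != 0.
  apply: contraNneq b0 => h; apply/eqP/phi_inj.
  have := congr1 (fun M : 'cV_m.+1 => M 0 0) h.
  by rewrite !mxE rmorph0.
have zbF : zF *m bF = 0 by rewrite -map_mxM zb map_mx0.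
have [w wb|g g0 hg] := hilbert_burch_pid bF0 zbF.
  have [s [d d0 [hs [y hy]]]] := phi_denom (fun i => w 0 i).
  have yb : (\row_i y i) *m b = 0.
    apply/matrixP=> i k; rewrite !ord1; apply: phi_inj.
    transitivity (phi s * (w *m bF) 0 0); last by rewrite wb !mxE mulr0 rmorph0.
    rewrite [in LHS]mxE [in RHS]mxE mulr_sumr rmorph_sum.
    by apply: eq_bigr => l _; rewrite rmorphM !mxE mulrA hy.
  have [r hr] := zspan yb.
  exists (d^-1%:P *: map_mx phi r).
  rewrite -scalemxAl -map_mxM -hr; apply/rowP=> i; rewrite !mxE -hy hs mulrA.
  by rewrite -polyCM mulVf // mul1r.
exists g => // i; have [c c0] := hg i; rewrite mxE => ->; exists c => //.
by rewrite -map_col' det_map_mx.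
Qed.
End HilbertBurchFlat.

Section DetHomog.
Variables (K : fieldType) (n m : nat) (M : 'M[{mpoly K[n]}]_m) (e d : 'I_m -> nat).
Hypothesis Mh : forall j k, hpart (d k) (e j) (M j k) = M j k.
Hypothesis M0 : \det M != 0.

Lemma entry_le j k : M j k != 0 -> (d k <= e j)%N.
Proof.
rewrite -(Mh j k) /hpart; case: leqP => // _; by rewrite eqxx.
Qed.

(** A nonzero product over a permutation s has degree sum_j (e j - d (s j)), which
    equals sum_j e j - sum_j d j and hence does not depend on s. *)
Lemma det_homog : exists2 s : 'S_m, forall j, M j (s j) != 0 &
  \det M \is (\sum_j (e j - d (s j))).-homog.
Proof.
have [s hs] : exists s : 'S_m, forall j, M j (s j) != 0.
  apply: NNPP => h; case/eqP: M0; rewrite /determinant big1 // => s _.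
  have [j hj] : exists j, M j (s j) == 0.
    apply: NNPP => h2; apply: h; exists s => j; apply/negP => h3.
    by apply: h2; exists j.
  by rewrite (bigD1 j) //= (eqP hj) mul0r mulr0.
exists s => //; apply: rpred_sum => t _.
have [/forallP ht|/forallPn [j /negPn/eqP hj]] :=
  boolP [forall j, M j (t j) != 0]; last first.
  by rewrite (bigD1 j) //= hj mul0r mulr0 rpred0.
rewrite -signr_odd; set sg := (-1) ^+ _.
have -> : sg * \prod_i M i (t i) = ((-1) ^+ t : K) *: \prod_i M i (t i).
  by rewrite /sg; case: (odd_perm t); rewrite ?scaleN1r ?scale1r ?mulN1r ?mul1r.
apply: dhomogZ.
have deq (t' : 'S_m) : (forall j, M j (t' j) != 0) ->
  (\sum_j (e j - d (t' j)) + \sum_j d j = \sum_j e j)%N.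
  move=> h; rewrite [X in (_ + X)%N](reindex_inj (@perm_inj _ t')) /= -big_split /=.
  by apply: eq_bigr => j _; rewrite subnK // entry_le.
have -> : (\sum_j (e j - d (s j)) = \sum_j (e j - d (t j)))%N.
  by apply/eqP; rewrite -(eqn_add2r (\sum_j d j)) !deq.
apply: (big_ind2 (fun (p : {mpoly K[n]}) k => p \is k.-homog)).
- exact: dhomog1.
- by move=> p1 k1 p2 k2; exact: dhomogM.
by move=> j _; rewrite -(Mh j (t j)) /hpart entry_le // pihomogP.
Qed.
End DetHomog.

Section Numerics.
Variables (K : closedFieldType) (n m : nat).
Local Notation S := {mpoly K[n.+1]}.
Variables (b : 'cV[S]_m.+1) (dg : 'I_m.+1 -> nat).
Variables (z : 'M[S]_(m, m.+1)) (eg : 'I_m -> nat).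
Hypothesis bh : forall i, b i 0 \is (dg i).-homog.
Hypothesis bne : forall i, b i 0 != 0.
Hypothesis minb : minimal_gens b.
Hypothesis hz : homog_rows dg z eg.
Hypothesis freez : free_syzygies b z.

(** In equal degrees the entry would be constant, hence 0 by minimality. *)
Lemma syz_entry_lt j i : z j i != 0 -> (dg i < eg j)%N.
Proof.
have [zb _ _] := freez.
have /rowP/(_ i) := hz j; rewrite !mxE /hpart; case: ltngtP => // [_ <-|e <-].
  by rewrite eqxx.
have : map_mx (mcoeff 0%MM) (row j z) = 0 by apply: minb; rewrite -row_mul zb row0.
move=> /rowP/(_ i); rewrite !mxE => z0.
by rewrite e subnn pihomog0E z0 mpolyC0 eqxx.
Qed.

Lemma minor_neq0 i : \det (col' i z) != 0.
Proof.
have [zb _ zspan] := freez.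
have [F [phi [inj den _]]] := generic_line (oner_neq0 S).
have [g g0 hg] := hilbert_burch_flat inj den (bne 0) zb zspan.
have [c c0 hb] := hg i.
apply: contraNneq (bne i) => d0; apply/eqP/inj.
by rewrite hb d0 rmorph0 scaler0 mulr0.
Qed.

Lemma minor_homog (i : 'I_m.+1) : exists2 s : {perm 'I_m},
  forall j, (dg (fintype.lift i (s j)) < eg j)%N &
  \det (col' i z) \is (\sum_j (eg j - dg (fintype.lift i (s j)))).-homog.
Proof.
have [|s hs hd] := @det_homog _ _ _ _ eg (dg \o fintype.lift i) _ (minor_neq0 i).
  by move=> j k; have /rowP/(_ (fintype.lift i k)) := hz j; rewrite !mxE.
exists s => // j; apply: syz_entry_lt.
by have := hs j; rewrite mxE.
Qed.

(** Compare the t-degrees in hilbert_burch_flat, on a line where no generator and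
    no minor loses degree. *)
Theorem degree_numerics :
  exists (F : fieldType) (phi : {rmorphism S -> {poly F}}),
  [/\ injective phi,
      forall (J : finType) (x : J -> {poly F}),
        exists s, exists2 d : F, d != 0 & phi s = d%:P /\
        exists y : J -> S, forall j, phi s * x j = phi (y j)
    & exists2 g, g != 0 & forall i : 'I_m.+1, (g %| phi (b i 0))%R /\
      exists2 s : {perm 'I_m}, forall j, (dg (fintype.lift i (s j)) < eg j)%N &
        dg i = ((size g).-1 + \sum_j (eg j - dg (fintype.lift i (s j))))%N].
Proof.
pose h : S := \prod_i (b i 0 * \det (col' i z)).
have h0 : h != 0 by apply/prodf_neq0 => i _; rewrite mulf_neq0 ?minor_neq0.
have [F [phi [inj den hphi]]] := generic_line h0.
have [zb _ zspan] := freez.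
have [g g0 hg] := hilbert_burch_flat inj den (bne 0) zb zspan.
exists F, phi; split=> //; exists g => // i; have [c c0 hb] := hg i.
split; first by rewrite hb dvdp_mulr.
have [s hs hd] := minor_homog i; exists s => //.
pose r := \prod_(j | j != i) (b j 0 * \det (col' j z)).
have hE : h = b i 0 * \det (col' i z) * r by rewrite /h (bigD1 i).
have sb : size (phi (b i 0)) = (dg i).+1.
  by apply: (hphi _ _ (\det (col' i z) * r)); rewrite // hE mulrA.
have sd := hphi _ _ (b i 0 * r) hd; rewrite hE -mulrA mulrCA in sd.
move: sb; rewrite hb size_mul ?size_scale ?sd //; last first.
  by rewrite -size_poly_gt0 size_scale // sd.
by rewrite addnS /= -(prednK (_ : 0 < size g)%N) ?size_poly_gt0 // => -[].
Qed.

(** An irreducible factor of g would contract to a prime of height one that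
    contains I. *)
Theorem degree_formula (I : idealr S) :
  (forall p, p \in I <-> exists c : 'rV_(m.+1), p = (c *m b) 0 0) ->
  height I 2 -> forall i : 'I_m.+1, exists2 s : {perm 'I_m},
    forall j, (dg (fintype.lift i (s j)) < eg j)%N &
    dg i = (\sum_j (eg j - dg (fintype.lift i (s j))))%N.
Proof.
move=> genI [_ hI] i.
have [F [phi [inj den [g g0 hg]]]] := degree_numerics.
have [_ [s hs hd]] := hg i; exists s => //.
suff g1 : (size g <= 1)%N by rewrite hd; case: (size g) g1 => [|[|]].
rewrite leqNgt; apply/negP => /irreducible_divisor [p irr pg].
have IP : {subset I <= contraction_ideal phi irr}.
  move=> x /genI [c ->]; rewrite /in_mem /= /contraction mxE rmorph_sum.
  elim/big_ind: _ => [|u v hu hv|j _]; [exact: dvdp0 | exact: dvdp_add |].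
  rewrite rmorphM dvdp_mull //; apply: dvdp_trans pg _; exact: (hg j).1.
have bI : b i 0 \in contraction_ideal phi irr.
  by apply/IP/genI; exists (delta_mx 0 i); rewrite -rowE mxE.
have := hI _ 1%N IP; suff : prime_height (contraction_ideal phi irr) 1.
  by move=> h /(_ h).
exact: (contraction_height inj den (bne i) bI).
Qed.

End Numerics.

(** * Standard bases *)

Section PredPart.
Variables (K : fieldType) (n : nat) (I : idealr {mpoly K[n]}).
Local Notation S := {mpoly K[n]}.

Lemma pred_part_mul0 d : pred_part_mul I d 0.
Proof. by exists [::]; split=> //; rewrite big_nil. Qed.

Lemma pred_part_mulD d p q :
  pred_part_mul I d p -> pred_part_mul I d q -> pred_part_mul I d (p + q).
Proof.
move=> [s [hs ->]] [t [ht ->]]; exists (s ++ t); rewrite big_cat; split=> // u.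
by rewrite mem_cat => /orP[/hs|/ht].
Qed.

Lemma pred_part_mul_form r d h p : h \is r.+1.-homog -> p \in I -> p \is d.-homog ->
  pred_part_mul I (d + r.+1) (h * p).
Proof.
move=> hh pI hp.
have h0 : h@_0 = 0 by apply: (dhomog_nemf_coeff hh); rewrite /= mdeg0.
have [q [hq qh]] := split_variables h0.
exists [seq (q i * p, 'X_i) | i <- enum 'I_n]; split.
  move=> _ /mapP[i _ ->]; rewrite addnS /=; split=> //.
    split; first by rewrite idealMr.
    by rewrite addnC dhomogM // qh.
  by rewrite /form_of_degree dhomogX /= mdeg1.
rewrite big_map big_enum hq mulr_suml; apply: eq_bigr => i _ /=.
by rewrite -mulrA mulrC.
Qed.
End PredPart.

Section StandardBasis.
Variables (K : fieldType) (n : nat) (I : idealr {mpoly K[n]}).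
Local Notation S := {mpoly K[n]}.
Local Notation ev0 := (mcoeff (0%MM : 'X_{1..n})).
Variable B : seq S.
Hypothesis sB : standard_basis I B.

Definition gen_col : 'cV[S]_(size B) := \col_i B`_i.
(** For a nonzero form, msize is the degree plus one. *)
Definition gen_deg (i : 'I_(size B)) := (msize B`_i).-1.

Lemma gen_homog i : gen_col i 0 \is (gen_deg i).-homog.
Proof.
have [h _ _] := sB; have [d hd] := h _ (mem_nth 0 (ltn_ord i)).
by rewrite mxE; exact: (dhomog_msize hd).
Qed.

Lemma gen_ideal p : p \in I <-> exists c : 'rV_(size B), p = (c *m gen_col) 0 0.
Proof.
have [_ gI _] := sB; split.
  move/gI => [s [hs ->]]; elim: s hs => [|u s IH] hs.
    by exists 0; rewrite big_nil mul0mx mxE.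
  have [|c hc] := IH; first by move=> v vs; apply: hs; rewrite inE vs orbT.
  have := hs u (mem_head _ _); rewrite -index_mem => lt.
  exists (u.1 *: delta_mx 0 (Ordinal lt) + c).
  rewrite big_cons hc mulmxDl -scalemxAl -rowE [RHS]mxE; congr (_ + _).
  by rewrite !mxE /= nth_index // -index_mem.
case=> c ->; apply/gI; exists [seq (c 0 i, B`_i) | i <- enum 'I_(size B)]; split.
  by move=> _ /mapP[i _ ->] /=; exact: mem_nth.
by rewrite big_map big_enum mxE; apply: eq_bigr => i _; rewrite mxE.
Qed.

Lemma gen_in i : B`_i \in I.
Proof.
have [ib|bi] := ltnP i (size B); last by rewrite nth_default // idealr0.
by apply/gen_ideal; exists (delta_mx 0 (Ordinal ib)); rewrite -rowE !mxE.
Qed.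

Lemma gen_neq0 : 0 \notin B.
Proof.
apply/negP=> B0; have [_ _ /(_ 0%N) [_ _ ind]] := sB.
set s := filter _ _ in ind.
have s0 : 0 \in s by rewrite mem_filter dhomog0.
move: s0; rewrite -index_mem => lt.
suff /eqP : (Ordinal lt == Ordinal lt)%:R = 0 :> K by rewrite eqxx oner_eq0.
apply: (ind (fun i => (i == Ordinal lt)%:R)).
rewrite big1 => [|i _]; first exact: pred_part_mul0.
case: eqP => [->|_]; last by rewrite scale0r.
by rewrite /= nth_index ?scaler0 // -index_mem.
Qed.

Lemma gen_uniq : uniq B.
Proof.
apply: count_mem_uniq => f.
have [fB|fB] := boolP (f \in B); last by rewrite (count_memPn fB).
have [/(_ f fB) [d fd] _ /(_ d) [_ _ ind]] := sB.
set s := filter _ _ in ind.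
have us : uniq s.
  apply/(uniqP 0) => i j; rewrite !inE => is_ js e; apply/eqP/negPn/negP => ij.
  pose c (k : 'I_(size s)) : K := (k == Ordinal is_)%:R - (k == Ordinal js)%:R.
  suff /eqP : c (Ordinal is_) = 0.
    by rewrite /c eqxx [_ == Ordinal js]/eq_op /= (negPf ij) subr0 oner_eq0.
  apply: (ind c).
  under eq_bigr => k _ do rewrite scalerBl.
  rewrite sumrB (bigD1 (Ordinal is_)) //= eqxx scale1r.
  rewrite big1 => [|k /negPf->]; last by rewrite scale0r.
  rewrite (bigD1 (Ordinal js)) //= eqxx scale1r.
  rewrite big1 => [|k /negPf->]; last by rewrite scale0r.
  by rewrite !addr0 e subrr; exact: pred_part_mul0.
have := count_uniq_mem f us; rewrite mem_filter fd fB /= => <-.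
rewrite count_filter; apply: eq_count => x /=.
by case: eqP => [->|//]; rewrite fd.
Qed.

(** In degree d = gen_deg i a syzygy c says that the combination of the generators
    of degree d with the constant terms of c lies in I_(d-1) S_1: the other
    generators that occur have smaller degree and coefficients of positive
    degree.  The elements of B of degree d are independent modulo that space. *)
Lemma gen_minimal : minimal_gens gen_col.
Proof.
move=> c cb; apply/rowP=> i; rewrite !mxE.
pose d := gen_deg i.
have bi0 k : B`_k != 0 -> (k < size B)%N.
  by apply: contraNT; rewrite -leqNgt => h; rewrite nth_default.
have [_ _ /(_ d) [_ _ ind]] := sB.
set s := filter _ _ in ind.
(* s is a sublist of B, so the coefficients are indexed by elements of B *)
pose C g : K := if insub (index g B) is Some k then ev0 (c 0 k) else 0.
have CB (k : 'I_(size B)) : C B`_k = ev0 (c 0 k).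
  rewrite /C index_uniq ?gen_uniq //; case: insubP => [k' _ /val_inj -> //|].
  by rewrite ltn_ord.
have is_ : B`_i \in s.
  by rewrite mem_filter mem_nth // andbT; have := gen_homog i; rewrite mxE.
have lt := is_; rewrite -index_mem in lt.
have := ind (fun k => C s`_k) _ (Ordinal lt); rewrite /= nth_index // CB; apply.
have -> : \sum_(k < size s) C s`_k *: s`_k =
    \sum_(k < size B | gen_deg k == d) C B`_k *: B`_k.
  transitivity (\sum_(g <- s) C g *: g); first by rewrite (big_nth 0) big_mkord.
  rewrite big_filter (big_nth 0) big_mkord; apply: eq_bigl => k.
  have hk := gen_homog k; rewrite mxE in hk.
  apply/idP/eqP => [hd|<- //]; apply: (dhomog_uniq _ hk hd).
  by apply: contraNneq gen_neq0 => <-; exact: mem_nth.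
have cb0 : \sum_k hpart (gen_deg k) d (c 0 k) * B`_k = 0.
  transitivity (pihomog mdeg d ((c *m gen_col) 0 0)); last first.
    by rewrite cb mxE raddf0.
  rewrite mxE raddf_sum; apply: eq_bigr => k _ /=.
  by rewrite (pihomogM _ _ (gen_homog k)) mxE.
have -> : \sum_(k < size B | gen_deg k == d) C B`_k *: B`_k =
    \sum_(k < size B | gen_deg k != d) hpart (gen_deg k) d (- c 0 k) * B`_k.
  rewrite (bigID (fun k => gen_deg k == d)) /= in cb0.
  move/eqP: cb0; rewrite addr_eq0 => /eqP cb0.
  transitivity (- \sum_(k < size B | gen_deg k != d)
                    hpart (gen_deg k) d (c 0 k) * B`_k); last first.
    by rewrite -sumrN; apply: eq_bigr => k _; rewrite raddfN mulNr.
  rewrite -cb0; apply: eq_bigr => k /eqP kd.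
  by rewrite CB /hpart kd leqnn subnn -mul_mpolyC pihomog0E.
elim/big_ind: _ => [|u v|k kd]; [exact: pred_part_mul0 | exact: pred_part_mulD |].
rewrite /hpart; case: leqP => [kled|_]; last first.
  by rewrite mul0r; exact: pred_part_mul0.
have [r dr] : exists r, (d = gen_deg k + r.+1)%N.
  exists (d - gen_deg k).-1; rewrite prednK ?subnKC // subn_gt0.
  by rewrite ltn_neqAle kd.
rewrite dr addKn; apply: pred_part_mul_form; [exact: pihomogP | exact: gen_in |].
by have := gen_homog k; rewrite mxE.
Qed.

Lemma gen_neq0_at i : gen_col i 0 != 0.
Proof. by rewrite mxE; apply: contraNneq gen_neq0 => <-; exact: mem_nth. Qed.

Lemma form_deg_ge k p : p \in I -> p \is k.-homog -> p != 0 ->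
  exists i, (gen_deg i <= k)%N.
Proof.
move=> /gen_ideal [c pE] pa p0; apply: NNPP => h; case/eqP: p0.
rewrite -(pihomog_dE pa) pE mxE raddf_sum big1 // => i _ /=.
rewrite (pihomogM _ _ (gen_homog i)) /hpart.
case: leqP => [le|_]; last exact: mul0r.
by case: h; exists i.
Qed.

(** That f annihilates a power of M modulo the other generators is a statement on
    syzygies: each monomial of large degree is the coefficient of some syzygy
    at f. *)
Lemma inessential_monomials i0 : inessential B B`_i0 -> (i0 < size B)%N ->
  exists t, forall mu : 'X_{1..n}, (t <= mdeg mu)%N ->
    exists2 w : 'rV[S]_(size B), w *m gen_col = 0 &
      forall i : 'I_(size B), i = i0 :> nat -> w 0 i = 'X_[mu].
Proof.
move=> [t ht] i0B; exists t => mu tmu.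
have Xpow : ideal_pow (@maxI K n) t 'X_[mu].
  have [s [r [st ->]]] : exists (s : seq 'I_n) r, size s = t /\
      'X_[mu] = 'X_[r] * \prod_(i <- s) ('X_i : S).
    elim: t tmu {ht} => [|t IH] tmu.
      by exists [::], mu; rewrite big_nil mulr1.
    have [s [r [st e]]] := IH (ltnW tmu).
    have r0 : r != 0%MM.
      apply: contraTneq tmu => r0; rewrite -leqNgt.
      have : msize ('X_[mu] : S) = msize (\prod_(i <- s) ('X_i : S)).
        by rewrite e r0 mpolyX0 mul1r.
      rewrite msizeX => /eqP; rewrite -st mprodXE msizeX mdeg_sum eqSS => /eqP ->.
      by under eq_bigr => i _ do rewrite mdeg1; rewrite sum1_size.
    have [i ri] : exists i, r i != 0%N.
      apply: NNPP => h; case/eqP: r0; apply/mnmP => i; rewrite mnmE.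
      by apply/eqP/negPn/negP => h2; apply: h; exists i.
    exists (i :: s), (r - U_(i))%MM; rewrite /= st; split=> //.
    by rewrite big_cons mulrA -mpolyXD submK ?lep1mP.
  exists [:: ('X_[r], \prod_(i <- s) 'X_i)]; rewrite big_seq1; split=> // u.
  rewrite inE => /eqP -> /=; exists [seq 'X_i | i <- s]; rewrite size_map big_map.
  split=> // _ /mapP[i _ ->]; exists [:: (1, 'X_i)]; rewrite big_seq1 mul1r.
  by split=> // u'; rewrite inE => /eqP -> /=; exists i.
have [s [hs e]] := ht _ Xpow.
have [c c0 hc] : exists2 c : 'rV[S]_(size B),
    forall i : 'I_(size B), i = i0 :> nat -> c 0 i = 0 &
    B`_i0 * 'X_[mu] = (c *m gen_col) 0 0.
  rewrite e; elim: s hs {e} => [|u s IH] hs.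
    by exists 0; rewrite ?big_nil ?mul0mx ?mxE // => i _; rewrite mxE.
  have [|c c0 hc] := IH; first by move=> v vs; apply: hs; rewrite inE vs orbT.
  have [uB ui0] := hs u (mem_head _ _); have lt := uB; rewrite -index_mem in lt.
  exists (u.1 *: delta_mx 0 (Ordinal lt) + c) => [i ii0|].
    rewrite !mxE c0 // addr0 /=; case: eqP => [e|]; last by rewrite mulr0.
    case: ui0; have /= := congr1 val e; rewrite ii0 => ->.
    by rewrite nth_index.
  rewrite big_cons hc mulmxDl -scalemxAl -rowE [RHS]mxE; congr (_ + _).
  by rewrite !mxE /= nth_index.
exists ('X_[mu] *: delta_mx 0 (Ordinal i0B) - c) => [|i ii0].
  apply/matrixP => i j; rewrite !ord1 mulmxBl -scalemxAl -rowE.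
  have entryB (M N : 'M[S]_1) x :
      (x *: M - N) 0 0 = x * M 0 0 - N 0 0 by rewrite !mxE.
  by rewrite entryB -hc 3!mxE /= mulrC subrr.
rewrite !mxE c0 // subr0 (_ : i == _) ?mulr1 //.
by apply/eqP/val_inj.
Qed.
End StandardBasis.

(** If b = A b' and b' = C b, then A C - 1 consists of syzygies of b, so the
    constant terms satisfy A(0) C(0) = 1. *)
Lemma minimal_gens_leq (K : fieldType) n nu nu' (b : 'cV[{mpoly K[n]}]_nu)
    (b' : 'cV[{mpoly K[n]}]_nu') :
  minimal_gens b ->
  (forall i, exists c : 'rV_nu', b i 0 = (c *m b') 0 0) ->
  (forall i, exists c : 'rV_nu, b' i 0 = (c *m b) 0 0) -> (nu <= nu')%N.
Proof.
move=> minb /fin_all_exists [a ha] /fin_all_exists [c hc].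
pose A := \matrix_i a i; pose C := \matrix_i c i.
have bA : b = A *m b'.
  apply/matrixP=> i j; rewrite ord1 ha -{1}[a i](rowK a) -row_mul mxE //.
have bC : b' = C *m b.
  apply/matrixP=> i j; rewrite ord1 hc -{1}[c i](rowK c) -row_mul mxE //.
have AC0 : (A *m C - 1%:M) *m b = 0 by rewrite mulmxBl mul1mx -mulmxA -bC -bA subrr.
have : map_mx (mcoeff 0%MM) A *m map_mx (mcoeff 0%MM) C = 1%:M.
  apply/eqP; rewrite -map_mxM -subr_eq0.
  rewrite -(map_mx1 (mcoeff (0%MM : 'X_{1..n}))) -map_mxB.
  apply/eqP/row_matrixP => i; rewrite row0 -map_row; apply: minb.
  by rewrite -row_mul AC0 row0.
exact: mulmx1_min.
Qed.

Lemma standard_basis_size (K : fieldType) n (I : idealr {mpoly K[n]}) B B' :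
  standard_basis I B -> standard_basis I B' -> (size B <= size B')%N.
Proof.
move=> sB sB'; apply: (minimal_gens_leq (gen_minimal sB)) => i.
  by apply/(gen_ideal sB'); rewrite mxE; exact: gen_in.
by apply/(gen_ideal sB); rewrite mxE; exact: gen_in.
Qed.

(** * Counting along an exact sequence *)

Definition independent (K : fieldType) (V : lmodType K) (J : finType)
    (v : J -> V) :=
  forall x : J -> K, \sum_j x j *: v j = 0 -> forall j, x j = 0.

Section ExactCount.
Variables (K : fieldType) (V W : lmodType K) (f : {linear V -> W}).
Variables (a c d h : nat).
Variables (u : 'I_a -> V) (z : 'I_d -> V) (w : 'I_c -> W) (s : 'I_h -> W).
Hypothesis u_ind : independent u.
Hypothesis w_ind : independent w.
Hypothesis z_ind : independent z.
Hypothesis z_u : forall k, spanned u (z k).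
Hypothesis f_z : forall k, f (z k) = 0.
Hypothesis ker_z : forall x, spanned u x -> f x = 0 -> spanned z x.
Hypothesis fu_w : forall i, spanned w (f (u i)).
Hypothesis s_w : forall l, spanned w (s l).
Hypothesis w_s : forall p, spanned w p ->
  exists y : 'I_h -> K, exists2 x, spanned u x & p - \sum_l y l *: s l = f x.
Hypothesis s_ind : forall (y : 'I_h -> K) x, spanned u x ->
  \sum_l y l *: s l = f x -> forall l, y l = 0.

Let lc (E : lmodType K) k (v : 'I_k -> E) (x : 'rV[K]_k) : E := \sum_i x 0 i *: v i.

Let lc_spanned (E : lmodType K) k (v : 'I_k -> E) p :
  spanned v p -> exists x, p = lc v x.
Proof.
case=> y ->; exists (\row_i y i); apply: eq_bigr => i _; by rewrite mxE.
Qed.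

Let spanned_lc (E : lmodType K) k (v : 'I_k -> E) x : spanned v (lc v x).
Proof. by exists (x 0). Qed.

Let lc_comp (E : lmodType K) k l (v : 'I_k -> E) (A : 'M[K]_(l, k)) x :
  lc (fun j => lc v (row j A)) x = lc v (x *m A).
Proof.
rewrite /lc; under eq_bigr => j _ do rewrite scaler_sumr.
rewrite exchange_big; apply: eq_bigr => i _; rewrite mxE scaler_suml.
by apply: eq_bigr => j _; rewrite mxE scalerA.
Qed.

Let lc_inj (E : lmodType K) k (v : 'I_k -> E) : independent v -> injective (lc v).
Proof.
move=> ind x y xy; apply/eqP; rewrite -subr_eq0; apply/eqP/rowP => i.
rewrite mxE [RHS]mxE; have := ind (fun i => x 0 i - y 0 i) _ i; rewrite !mxE; apply.
under eq_bigr => j _ do rewrite scalerBl.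
by rewrite sumrB; apply/eqP; rewrite subr_eq0; apply/eqP.
Qed.

Let lc0 (E : lmodType K) k (v : 'I_k -> E) : lc v 0 = 0.
Proof. by rewrite /lc big1 // => i _; rewrite mxE scale0r. Qed.

(** The hypotheses describe an exact sequence 0 -> span z -> span u -> span w,
    the last map being f, with a cokernel of basis s; the matrices of z, of f
    and of s in the bases u and w have ranks d, a - d and h = c - (a - d). *)
Lemma exact_count : (h + a = c + d)%N.
Proof.
have fam (E : lmodType K) k l (v : 'I_k -> E) (g : 'I_l -> E) :
    (forall j, spanned v (g j)) -> exists A, forall j, g j = lc v (row j A).
  move=> hg; have /fin_all_exists [x hx] j : exists x, g j = lc v x.
    by apply: lc_spanned.
  by exists (\matrix_j x j) => j; rewrite rowK.
have famlc (E : lmodType K) k l (v : 'I_k -> E) (g : 'I_l -> E) A x :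
    (forall j, g j = lc v (row j A)) -> lc g x = lc v (x *m A).
  by move=> hg; rewrite -lc_comp; apply: eq_bigr => j _; rewrite hg.
have [A1 hA1] := fam _ _ _ _ _ fu_w.
have [A2 hA2] := fam _ _ _ _ _ z_u.
have [A3 hA3] := fam _ _ _ _ _ s_w.
have flc x : f (lc u x) = lc w (x *m A1).
  rewrite -(famlc _ _ _ _ _ _ _ hA1) linear_sum; apply: eq_bigr => i _.
  by rewrite linearZ.
have kerE : (kermx A1 :=: A2)%MS.
  apply/eqmxP/andP; split.
    apply/row_subP => i; set x := row i _.
    have xA : x *m A1 = 0 by rewrite -row_mul mulmx_ker row0.
    have [|y hy] := lc_spanned (ker_z (spanned_lc u x) _).
      by rewrite flc xA lc0.
    apply/submxP; exists y; apply: (lc_inj u_ind).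
    by rewrite hy (famlc _ _ _ _ _ _ _ hA2).
  apply/sub_kermxP/row_matrixP => i; rewrite row_mul row0.
  by apply: (lc_inj w_ind); rewrite -flc -hA2 f_z lc0.
have rA2 : \rank A2 = d.
  apply/eqP/inj_row_free => x xA; apply: (lc_inj z_ind).
  by rewrite (famlc _ _ _ _ _ _ _ hA2) xA !lc0.
have A3disj (x : 'rV_h) (y : 'rV_a) : x *m A3 = y *m A1 -> x = 0.
  move=> e; apply/rowP => l; rewrite mxE.
  apply: (s_ind (spanned_lc u y) _ l); rewrite flc -e.
  exact: famlc.
have rA3 : \rank A3 = h.
  by apply/eqP/inj_row_free => x xA; apply: (A3disj x 0); rewrite mul0mx.
have disj : (A3 :&: A1)%MS = 0.
  apply/eqP; rewrite -submx0; apply/row_subP => i.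
  have := row_sub i (A3 :&: A1)%MS; rewrite sub_capmx.
  case/andP=> [/submxP [x hx] /submxP [y hy]].
  have x0 := A3disj x y (etrans (esym hx) hy).
  by rewrite hx x0 mul0mx sub0mx.
have full : \rank (A3 + A1)%MS = c.
  apply/eqP; rewrite -[_ == _]/(row_full _) -sub1mx.
  apply/row_subP => i; rewrite rowE mulmx1.
  have [y [x xu e]] := w_s (spanned_lc w (delta_mx 0 i)).
  have [x' hx'] := lc_spanned xu.
  apply/sub_addsmxP; exists (\row_l y l, x') => /=.
  apply: (lc_inj w_ind).
  have lcD x1 x2 : lc w (x1 + x2) = lc w x1 + lc w x2.
    by rewrite /lc -big_split; apply: eq_bigr => k _; rewrite mxE scalerDl.
  rewrite lcD -flc -hx' -e -(famlc _ _ _ _ _ _ _ hA3).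
  rewrite addrC -addrA [X in _ = _ + X](_ : _ = 0) ?addr0 //.
  apply/eqP; rewrite addrC subr_eq0; apply/eqP; apply: eq_bigr => l _.
  by rewrite mxE.
have := mxrank_ker A1; rewrite kerE rA2 => dE.
have := mxrank_disjoint_sum disj; rewrite full rA3 => ->.
by rewrite dE -addnA subnKC // rank_leq_row.
Qed.
End ExactCount.

Section Reindex.
Variables (K : fieldType) (V : lmodType K) (J : finType) (v : J -> V).

Definition ord_family (k : 'I_#|J|) : V := v (enum_val k).

Lemma sum_ord_family (x : J -> K) :
  \sum_j x j *: v j = \sum_k x (enum_val k) *: ord_family k.
Proof.
rewrite (reindex (@enum_val J predT)) //=.
by apply: onW_bij; exact: enum_val_bij.
Qed.

Lemma spanned_ord_family p : spanned ord_family p <-> spanned v p.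
Proof.
split=> [[x ->]|[x ->]].
  exists (x \o enum_rank); rewrite sum_ord_family.
  by apply: eq_bigr => k _; rewrite /= enum_valK.
by exists (x \o enum_val); rewrite sum_ord_family.
Qed.

Lemma independent_ord_family : independent v -> independent ord_family.
Proof.
move=> ind x e k; rewrite -(enum_valK k); apply: (ind (x \o enum_rank)).
by rewrite sum_ord_family -[RHS]e; apply: eq_bigr => l _; rewrite /= enum_valK.
Qed.
End Reindex.

(** * The Hilbert function *)

Section Monomials.
Variable n : nat.

Definition mono_seq d : seq 'X_{1..n.+1} :=
  [seq s2m t | t : d.-tuple 'I_n.+1 <- enum (basis n.+1 d)].

(** The number of monomials of degree t - d in n + 1 variables. *)
Definition mono_count (t d : nat) : nat :=
  if (d <= t)%N then 'C(t - d + n, t - d) else 0.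

Definition mono (t d : nat) (k : 'I_(mono_count t d)) : 'X_{1..n.+1} :=
  nth 0%MM (mono_seq (t - d)) k.

Lemma mono_le t d (k : 'I_(mono_count t d)) : (d <= t)%N.
Proof.
by case: k => k; rewrite /mono_count; case: (leqP d t) => //; rewrite ltn0.
Qed.

Lemma mono_lt t d (k : 'I_(mono_count t d)) : (k < size (mono_seq (t - d)))%N.
Proof. by have := ltn_ord k; rewrite {2}/mono_count (mono_le k) size_basis. Qed.

Lemma mono_deg t d (k : 'I_(mono_count t d)) : mdeg (mono k) = (t - d)%N.
Proof. by apply/eqP; rewrite basis_cover mem_nth // mono_lt. Qed.

Lemma mono_inj t d : injective (@mono t d).
Proof.
move=> k l /eqP; rewrite nth_uniq ?uniq_basis ?mono_lt // => /eqP.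
exact: val_inj.
Qed.

Lemma mono_cover t d mu : (d <= t)%N -> mdeg mu = (t - d)%N ->
  exists k : 'I_(mono_count t d), mono k = mu.
Proof.
move=> dt /eqP; rewrite basis_cover => h.
have lt : (index mu (mono_seq (t - d)) < mono_count t d)%N.
  by rewrite /mono_count dt -size_basis index_mem.
by exists (Ordinal lt); rewrite /mono /= nth_index.
Qed.

Variable K : fieldType.
Local Notation S := {mpoly K[n.+1]}.

Lemma hpart_expand t d (p : S) :
  hpart d t p = \sum_(k < mono_count t d) p@_(mono k) *: 'X_[mono k].
Proof.
rewrite /hpart; case: leqP => [dt|td]; last first.
  by rewrite big1 // => k _; have := mono_le k; rewrite leqNgt td.
apply/mpolyP=> mu; rewrite mcoeff_pihomog raddf_sum /=.
have [mud|nmud] := eqVneq.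
  have [k hk] := mono_cover dt mud; subst mu.
  rewrite (bigD1 k) //= big1 => [|l lk].
    by rewrite mcoeffZ mcoeffX eqxx mulr1 addr0.
  by rewrite mcoeffZ mcoeffX (inj_eq (@mono_inj _ _)) (negPf lk) mulr0.
rewrite big1 // => k _; rewrite mcoeffZ mcoeffX; case: eqP; rewrite ?mulr0 // => e.
by move: nmud; rewrite -e mono_deg eqxx.
Qed.

Lemma mono_independent t d :
  independent (fun k : 'I_(mono_count t d) => 'X_[mono k] : S).
Proof.
move=> x e k; have := congr1 (mcoeff (mono k)) e.
rewrite raddf_sum raddf0 (bigD1 k) //= big1 => [|l lk].
  by rewrite mcoeffZ mcoeffX eqxx mulr1 addr0.
by rewrite mcoeffZ mcoeffX (inj_eq (@mono_inj _ _)) (negPf lk) mulr0.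
Qed.

Lemma hpart_mono t d (k : 'I_(mono_count t d)) :
  hpart d t ('X_[mono k] : S) = 'X_[mono k].
Proof.
by rewrite /hpart (mono_le k) pihomog_dE // dhomogX /= mono_deg.
Qed.

Lemma hpart0 t (p : S) : hpart 0 t p = pihomog mdeg t p.
Proof. by rewrite /hpart subn0. Qed.
End Monomials.

Section HilbertFunction.
Variables (K : fieldType) (n nu m : nat).
Local Notation S := {mpoly K[n.+1]}.
Variables (I : idealr S) (b : 'cV[S]_nu) (dg : 'I_nu -> nat).
Variables (z : 'M[S]_(m, nu)) (eg : 'I_m -> nat).
Hypothesis bh : forall i, b i 0 \is (dg i).-homog.
Hypothesis genI : forall p, p \in I <-> exists c : 'rV_nu, p = (c *m b) 0 0.
Hypothesis hz : homog_rows dg z eg.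
Hypothesis freez : free_syzygies b z.
Variable t : nat.

Let V := {ffun 'I_nu -> S}.
Let f (x : V) : S := \sum_i x i * b i 0.
Let f_lin : linear f.
Proof.
move=> c x y; rewrite /f scaler_sumr -big_split; apply: eq_bigr => i _ /=.
by rewrite !ffunE mulrDl scalerAl.
Qed.
HB.instance Definition _ := GRing.isLinear.Build K V S _ f f_lin.

Let T1 : finType := {i : 'I_nu & 'I_(mono_count n t (dg i))}.
Let u (p : T1) : V := [ffun i => if i == tag p then 'X_[mono (tagged p)] else 0].
Let T2 : finType := {j : 'I_m & 'I_(mono_count n t (eg j))}.
Let zf (p : T2) : V := [ffun i => 'X_[mono (tagged p)] * z (tag p) i].
Let w (k : 'I_(mono_count n t 0)) : S := 'X_[mono k].

Let tag1 i (k : 'I_(mono_count n t (dg i))) : T1 :=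
  Tagged (fun i => 'I_(mono_count n t (dg i))) k.
Let tag2 j (k : 'I_(mono_count n t (eg j))) : T2 :=
  Tagged (fun j => 'I_(mono_count n t (eg j))) k.

Let homV (x : V) := forall i, hpart (dg i) t (x i) = x i.

Let sum_sig (E : zmodType) (J : finType) (T : J -> finType)
    (F : forall j, T j -> E) :
  \sum_(p : {j : J & T j}) F (tag p) (tagged p) = \sum_j \sum_(k : T j) F j k.
Proof. by apply/esym; exact: (sig_big_dep xpredT (fun _ => xpredT) F). Qed.

Let u_coord (x : T1 -> K) i :
  (\sum_p x p *: u p) i =
  \sum_(k < mono_count n t (dg i)) x (tag1 k) *: 'X_[mono k] :> S.
Proof.
rewrite sum_ffunE.
under eq_bigr => p _ do rewrite !ffunE.
pose F i' (k : 'I_(mono_count n t (dg i'))) : S :=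
  x (tag1 k) *: (if i == i' then 'X_[mono k] else 0).
transitivity (\sum_(p : T1) F (tag p) (tagged p)).
  by apply: eq_bigr => -[i' k] _.
rewrite sum_sig (bigD1 i) //= [X in _ + X]big1 ?addr0 => [|i' ii'].
  by apply: eq_bigr => k _; rewrite /F eqxx.
by apply: big1 => k _; rewrite /F eq_sym (negPf ii') scaler0.
Qed.

Let span_u x : spanned u x <-> homV x.
Proof.
split=> [[y ->] i|h].
  rewrite u_coord raddf_sum; apply: eq_bigr => k _ /=.
  by rewrite linearZ /= hpart_mono.
exists (fun p => (x (tag p))@_(mono (tagged p))); apply/ffunP=> i.
by rewrite u_coord -[LHS]h hpart_expand.
Qed.

Let span_w p : spanned w p <-> p \is t.-homog.
Proof.
split=> [[y ->]|h].
  by apply: rpred_sum => k _; apply: rpredZ; rewrite dhomogX /= mono_deg subn0.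
by exists (fun k => p@_(mono k)); rewrite -hpart_expand hpart0 pihomog_dE.
Qed.

Let u_ind : independent u.
Proof.
move=> x e [i k]; have /ffunP/(_ i) := e; rewrite u_coord ffunE => ei.
exact: (mono_independent
  (x := fun k : 'I_(mono_count n t (dg i)) => x (tag1 k)) ei k).
Qed.

Let z_comb (x : T2 -> K) : \sum_p x p *: zf p =
  [ffun i => ((\row_j \sum_(k < mono_count n t (eg j))
                 x (tag2 k) *: ('X_[mono k] : S)) *m z) 0 i].
Proof.
apply/ffunP=> i; rewrite sum_ffunE !ffunE mxE.
under eq_bigr => p _ do rewrite !ffunE.
pose F j (k : 'I_(mono_count n t (eg j))) : S :=
  x (tag2 k) *: ('X_[mono k] * z j i).
transitivity (\sum_(p : T2) F (tag p) (tagged p)).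
  by apply: eq_bigr => -[j k] _.
rewrite sum_sig; apply: eq_bigr => j _; rewrite mxE mulr_suml.
by apply: eq_bigr => k _; rewrite /F scalerAl.
Qed.

Let z_ind : independent zf.
Proof.
have [_ zfree _] := freez.
move=> x e [j k]; move: e; rewrite z_comb => e.
have /zfree/rowP/(_ j) : (\row_j \sum_(k < mono_count n t (eg j))
    x (tag2 k) *: ('X_[mono k] : S)) *m z = 0.
  by apply/rowP=> i; have /ffunP/(_ i) := e; rewrite !ffunE => ->; rewrite mxE.
rewrite !mxE => ej; exact: (mono_independent
  (x := fun k : 'I_(mono_count n t (eg j)) => x (tag2 k)) ej k).
Qed.

Let hz_entry j i : hpart (dg i) (eg j) (z j i) = z j i.
Proof. by have /rowP/(_ i) := hz j; rewrite !mxE. Qed.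

Let f_hom x : homV x -> f x \is t.-homog.
Proof.
move=> h; apply: rpred_sum => i _; rewrite -(h i) -(pihomogM _ _ (bh i)).
exact: pihomogP.
Qed.

Let f_row (c : 'rV[S]_nu) : f [ffun i => c 0 i] = (c *m b) 0 0.
Proof. by rewrite mxE; apply: eq_bigr => i _; rewrite ffunE. Qed.

(** Take the exact sequence in degree t: the monomial vectors X^mu e_i form a basis
    of (sum_i S(-dg i))_t, the multiples X^kappa z_j a basis of the syzygies in it,
    and s a basis of S_t / I_t. *)
Lemma hilbert_function_count s :
  basis_mod (@form_of_degree K n.+1 t) (ideal_part I t) s ->
  (size s + \sum_i mono_count n t (dg i) =
   mono_count n t 0 + \sum_j mono_count n t (eg j))%N.
Proof.
move=> [sV sspan sind]; have [zb zfree zspan] := freez.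
pose sf (l : 'I_(size s)) : S := s`_l.
have card_sig k (g : 'I_k -> nat) :
    #|{: {i : 'I_k & 'I_(mono_count n t (g i))}}| = (\sum_i mono_count n t (g i))%N.
  rewrite card_tagged sumnE big_map big_enum; apply: eq_bigr => i _.
  by rewrite card_ord.
rewrite -!card_sig.
have fhom x : homV x -> f x \in I.
  move=> _; apply/genI; exists (\row_i x i); rewrite -f_row.
  by apply: eq_bigr => i _; rewrite ffunE mxE.
apply: (@exact_count _ _ _ f _ _ _ _ (ord_family u) (ord_family zf) w sf).
- exact: independent_ord_family.
- exact: mono_independent.
- exact: independent_ord_family.
- move=> k; apply/spanned_ord_family/span_u => i; rewrite /ord_family ffunE.
  by rewrite (hpartM _ _ (hz_entry _ _)) hpart_mono.
- move=> k; rewrite /ord_family; set p := enum_val k.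
  rewrite (_ : zf p = [ffun i => ('X_[mono (tagged p)] *: row (tag p) z) 0 i]).
    apply: etrans (f_row _) _.
    by rewrite -scalemxAl -row_mul zb row0 scaler0 mxE.
  by apply/ffunP=> i; rewrite !ffunE !mxE.
- move=> x /spanned_ord_family/span_u hx fx; apply/spanned_ord_family.
  pose c := \row_i x i.
  have cb : c *m b = 0.
    apply/matrixP=> i k; rewrite !ord1 -f_row [RHS]mxE -[RHS]fx.
    by apply: eq_bigr => l _; rewrite ffunE mxE.
  have [r hr] := zspan _ cb.
  have vc : vpart dg t c = c by apply/rowP=> i; rewrite !mxE.
  exists (fun p => (r 0 (tag p))@_(mono (tagged p))).
  rewrite z_comb; apply/ffunP => i; rewrite ffunE.
  transitivity (c 0 i); first by rewrite mxE.
  rewrite -vc hr (vpart_mulmx _ _ hz); congr ((_ *m z) 0 i).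
  by apply/rowP=> j; rewrite !mxE hpart_expand.
- move=> k; apply/span_w/f_hom/span_u; exact: spanned_mem.
- by move=> l; apply/span_w; apply: sV; exact: mem_nth.
- move=> p /span_w hp; have [y [yI yh]] := sspan p hp.
  exists y; have [c hc] := (genI _).1 yI.
  exists [ffun i => vpart dg t c 0 i].
    apply/spanned_ord_family/span_u => i; rewrite ffunE mxE.
    exact: hpart_id.
  by apply/esym; apply: etrans (f_row _) _; rewrite (vpart_mul bh) -hc pihomog_dE.
move=> y x /spanned_ord_family/span_u hx e; apply: sind; rewrite /ideal_part.
by rewrite e; split; [exact: fhom | exact: f_hom].
Qed.
End HilbertFunction.

(** * The multiplicity *)

Lemma poly_eventually_eq (R : numDomainType) (p q : {poly R}) t0 :
  (forall t, (t0 <= t)%N -> p.[t%:R] = q.[t%:R]) -> p = q.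
Proof.
move=> h; apply/eqP; rewrite -subr_eq0; apply/negPn/negP => pq0.
pose rs := [seq (t0 + i)%:R : R | i <- iota 0 (size (p - q))].
have : (size rs < size (p - q)%R)%N.
  apply: max_poly_roots => //.
    apply/allP => _ /mapP[i _ ->].
    by rewrite rootE hornerD hornerN h ?leq_addr // subrr.
  rewrite map_inj_uniq ?iota_uniq // => i j /eqP.
  by rewrite eqr_nat eqn_add2l => /eqP.
by rewrite size_map size_iota ltnn.
Qed.

Lemma comp_poly_taylor (R : comNzRingType) (p : {poly R}) (h : R) N :
  (size p <= N)%N -> p \Po ('X + h%:P) = \sum_(k < N) h ^+ k *: p^`N(k).
Proof.
move=> pN; have pN' : (size p^:P <= N)%N.
  exact: leq_trans (size_poly _ _) pN.
rewrite /comp_poly (@nderiv_taylor_wide _ N) //; last exact: mulrC.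
apply: eq_bigr => k _; rewrite nderivn_map -[_.['X]]/(_ \Po 'X) comp_polyXr.
by rewrite -rmorphXn mulrC mul_polyC.
Qed.

Section BinomialPoly.
Variable n : nat.

(** The polynomial taking the value 'C(k + n, n) at k. *)
Definition bin_poly : {poly rat} :=
  (n`!%:R)^-1 *: \prod_(i < n) ('X + ((n - i)%N%:R)%:P).

Lemma bin_poly_eval k : bin_poly.[k%:R] = 'C(k + n, n)%:R.
Proof.
rewrite hornerZ horner_prod.
have -> : \prod_(i < n) ('X + ((n - i)%N%:R)%:P : {poly rat}).[k%:R] =
    ((k + n) ^_ n)%:R.
  rewrite ffact_prod natr_prod; apply: eq_bigr => i _.
  by rewrite hornerD hornerX hornerC -natrD addnBA // ltnW.
rewrite -bin_ffact natrM mulrC mulfK // pnatr_eq0 -lt0n.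
exact: fact_gt0.
Qed.

Lemma bin_poly_coef : bin_poly`_n = (n`!%:R)^-1 /\ (size bin_poly <= n.+1)%N.
Proof.
have mon : \prod_(i < n) ('X + ((n - i)%N%:R)%:P : {poly rat}) \is monic.
  by apply: monic_prod => i _; rewrite monicXaddC.
have sz : size (\prod_(i < n) ('X + ((n - i)%N%:R)%:P : {poly rat})) = n.+1.
  rewrite size_prod => [|i _]; last by rewrite monic_neq0 // monicXaddC.
  under eq_bigr => i _ do rewrite size_XaddC.
  by rewrite sum_nat_const card_ord muln2 -addnn -addSn addnK.
split; last by rewrite -[X in (_ <= X)%N]sz size_scale_leq.
rewrite coefZ; have := monicP mon; rewrite lead_coefE sz /= => ->.
by rewrite mulr1.
Qed.

Lemma mono_count_poly t d : (d <= t)%N ->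
  (mono_count n t d)%:R = (bin_poly \Po ('X + (- d%:R)%:P)).[t%:R] :> rat.
Proof.
move=> dt; rewrite horner_comp hornerD hornerX hornerC -natrB // bin_poly_eval.
by rewrite /mono_count dt -bin_sub ?leq_addr // addKn.
Qed.
End BinomialPoly.

Section Multiplicity.
Variables (n m : nat) (dg : 'I_m.+1 -> nat) (eg : 'I_m -> nat).
Variables (H : nat -> nat) (Q : {poly rat}) (t0 : nat).
Hypothesis HE : forall t,
  (H t + \sum_i mono_count n t (dg i) =
   mono_count n t 0 + \sum_j mono_count n t (eg j))%N.
Hypothesis HQ : forall t, (t0 <= t)%N -> (H t)%:R = Q.[t%:R].
Hypothesis sumde : (\sum_i dg i = \sum_j eg j)%N.

(** By Taylor expansion, moment k is the coefficient of the k-th divided derivative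
    of bin_poly in the Hilbert polynomial. *)
Let moment k : rat :=
  0 ^+ k - \sum_i (- (dg i)%:R) ^+ k + \sum_j (- (eg j)%:R) ^+ k.

Lemma hilbert_poly_expansion : Q = \sum_(k < n.+1) moment k *: (bin_poly n)^`N(k).
Proof.
have [_ szP] := bin_poly_coef n.
pose P d := bin_poly n \Po ('X + (- d%:R)%:P).
have -> : \sum_(k < n.+1) moment k *: (bin_poly n)^`N(k) =
    P 0%N - \sum_i P (dg i) + \sum_j P (eg j).
  rewrite /P (comp_poly_taylor _ szP).
  under [X in _ = _ - X + _]eq_bigr => i _ do rewrite (comp_poly_taylor _ szP).
  under [X in _ = _ - _ + X]eq_bigr => j _ do rewrite (comp_poly_taylor _ szP).
  rewrite exchange_big [X in _ = _ - _ + X]exchange_big /= -sumrB -big_split /=.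
  apply: eq_bigr => k _; rewrite /moment scalerDl scalerBl oppr0 !scaler_suml.
  by [].
pose t1 := (t0 + \sum_i dg i + \sum_j eg j)%N.
apply: (@poly_eventually_eq _ _ _ t1) => t tt.
rewrite -HQ; last by apply: leq_trans tt; rewrite /t1 -addnA leq_addr.
have dt i : (dg i <= t)%N.
  apply: leq_trans tt; rewrite /t1 addnAC (bigD1 i) //= addnCA leq_addr //.
have et j : (eg j <= t)%N.
  apply: leq_trans tt; rewrite /t1 [X in (_ <= _ + X)%N](bigD1 j) //=.
  by rewrite addnCA leq_addr.
rewrite !hornerE !horner_sum.
under eq_bigr => i _ do rewrite -mono_count_poly //.
under [X in _ = _ + X]eq_bigr => j _ do rewrite -mono_count_poly //.
rewrite -mono_count_poly // -!natr_sum addrAC; apply/eqP.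
by rewrite eq_sym subr_eq -!natrD HE.
Qed.

Let moment0 : moment 0 = 0.
Proof.
rewrite /moment expr0; under eq_bigr => i _ do rewrite expr0.
under [X in _ + X]eq_bigr => i _ do rewrite expr0.
rewrite !sumr_const !card_ord -[_ *+ m.+1]natr1 opprD addrCA subrr addr0.
by rewrite addNr.
Qed.

Let moment1 : moment 1 = 0.
Proof.
rewrite /moment expr1; under eq_bigr => i _ do rewrite expr1.
under [X in _ + X]eq_bigr => i _ do rewrite expr1.
by rewrite !sumrN -!natr_sum sumde opprK add0r subrr.
Qed.

(** The moments of order 0 and 1 vanish, so the Hilbert polynomial has degree at
    most n - 2. *)
Lemma hilbert_poly_coef j : (n < j + 2)%N -> Q`_j = 0.
Proof.
move=> nj; rewrite hilbert_poly_expansion coef_sum big1 // => k _.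
have [_ szP] := bin_poly_coef n.
rewrite coefZ coef_nderivn; case: (nat_of_ord k) => [|[|k']].
- by rewrite moment0 mul0r.
- by rewrite moment1 mul0r.
rewrite [_`__]nth_default ?mul0rn ?mulr0 // (leq_trans szP) //.
by rewrite (leq_trans nj) // addnC leq_add2r.
Qed.

Hypothesis sumsq : (\sum_i dg i ^ 2 + m * m.+1 <= \sum_j eg j ^ 2)%N.
Hypothesis nm : (n < m)%N.

Lemma moment2_ge : (n.+1 * n.+2)%:R <= moment 2.
Proof.
have -> : moment 2 = (\sum_j eg j ^ 2)%N%:R - (\sum_i dg i ^ 2)%N%:R.
  rewrite /moment expr0n /= add0r addrC !natr_sum.
  congr (_ - _); apply: eq_bigr => i _.
    by rewrite sqrrN natrX.
  by rewrite sqrrN natrX.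
rewrite lerBrDl -natrD ler_nat (leq_trans _ sumsq) // leq_add2l.
by rewrite leq_mul.
Qed.

Lemma hilbert_poly_lead n' : n = n'.+2 ->
  (n')`!%:R * Q`_n' = moment 2 / 2.
Proof.
move=> nE; have [lc szP] := bin_poly_coef n.
rewrite hilbert_poly_expansion coef_sum.
have lt : (2 < n.+1)%N by rewrite nE.
rewrite (bigD1 (Ordinal lt)) //= big1 ?addr0 => [|k].
  rewrite coefZ coef_nderivn [(2 + n')%N](_ : _ = n) ?lc ?nE //.
  have D0 : (n'.+2)`!%:R != 0 :> rat by rewrite pnatr_eq0 -lt0n fact_gt0.
  rewrite -[X in _ * (_ * X) = _]mulr_natr mulrCA; congr (_ * _).
  rewrite mulrCA -[RHS]mul1r -[X in X / _](mulVf D0) -mulrA; congr (_ * _).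
  rewrite -(@bin_fact n'.+2 2) // subn2 /= (_ : 2`! = 2%N) //.
  rewrite !natrM [2%:R * _]mulrC mulrA.
  by rewrite mulfK ?pnatr_eq0 // mulrC.
move=> k2; rewrite coefZ coef_nderivn; move: k2; rewrite -val_eqE /=.
case: (nat_of_ord k) => [|[|[|k']]] // _.
- by rewrite moment0 mul0r.
- by rewrite moment1 mul0r.
rewrite [_`__]nth_default ?mul0rn ?mulr0 // (leq_trans szP) //.
by rewrite nE addSn addSn addSn !ltnS leq_addl.
Qed.

Hypothesis dgn : forall i, (n < dg i)%N.
Hypothesis egn : forall j, (n < eg j)%N.

(** For n >= 2 the multiplicity is moment 2 / 2.  For n < 2 the Hilbert polynomial
    is 0 and the multiplicity is a sum of values of H, which for t <= n are those
    of the polynomial ring, all generators having degree above n. *)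
Theorem multiplicity_lower_bound :
  (n.+1 * n.+2)%:R / 2 <= if Q == 0 then (\sum_(t < t0) H t)%:R
                          else ((size Q).-1)`!%:R * lead_coef Q.
Proof.
have [n2|n2] := ltnP n 2.
  have Q0 : Q = 0.
    apply/polyP => j; rewrite coef0 hilbert_poly_coef //.
    by rewrite (leq_trans n2) // leq_addl.
  rewrite Q0 eqxx.
  have Ht t : (t <= n)%N -> H t = 'C(t + n, t).
    move=> tn; have := HE t.
    rewrite !big1 => [|j _|i _]; last 2 first.
    - by rewrite /mono_count leqNgt (leq_ltn_trans tn).
    - by rewrite /mono_count leqNgt (leq_ltn_trans tn).
    by rewrite !addn0 => ->; rewrite /mono_count subn0.
  have nt0 : (n < t0)%N.
    rewrite ltnNge; apply/negP => /HQ /eqP; rewrite Q0 horner0 Ht // pnatr_eq0.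
    by rewrite -leqn0 leqNgt bin_gt0 leq_addr.
  rewrite ler_pdivrMr // -natrM ler_nat.
  have -> : (\sum_(t < t0) H t = \sum_(0 <= t < n.+1) 'C(t + n, t) +
      \sum_(n.+1 <= t < t0) H t)%N.
    rewrite -(big_mkord xpredT H) (big_cat_nat (n := n.+1)) //=; congr (_ + _)%N.
    by apply: eq_big_nat => t /andP[_ tn]; rewrite Ht.
  rewrite mulnDl; apply: leq_trans (leq_addr _ _).
  by move: n2; clear; case: n => [|[|]] //= _; rewrite unlock.
have [n' nE] : exists n', n = n'.+2 by exists (n - 2)%N; rewrite -addn2 subnK.
have moment2_gt0 : 0 < moment 2 by apply: lt_le_trans moment2_ge; rewrite ltr0n.
have lead := hilbert_poly_lead nE.
have Qn' : Q`_n' != 0.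
  apply: contraTneq moment2_gt0 => q0; move/eqP: lead; rewrite q0 mulr0 eq_sym.
  by rewrite mulf_eq0 invr_eq0 pnatr_eq0 orbF => /eqP ->; rewrite ltxx.
have szQ : size Q = n'.+1.
  apply/eqP; rewrite eqn_leq; apply/andP; split.
    apply/leq_sizeP => j nj; apply: hilbert_poly_coef.
    by rewrite nE addn2 !ltnS.
  by rewrite ltnNge; apply: contra Qn' => /leq_sizeP -> //.
rewrite -size_poly_eq0 szQ /= lead_coefE szQ /= lead.
by rewrite ler_pM2r ?invr_gt0 // moment2_ge.
Qed.
End Multiplicity.

(** * Essential elements *)

(** Put u_j = e_j - d_(s j), so that the smallest degree D is sum_j u_j.  The first
    equality is this definition; in the second claim, e_j^2 - d_(s j)^2 is
    2 d_(s j) u_j + u_j^2 >= 2 D u_j + u_j, whose sum is 2 D^2 + D, and D >= m. *)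
Lemma degree_sums m (dg : 'I_m.+1 -> nat) (eg : 'I_m -> nat) i0 (s : {perm 'I_m}) :
  (forall i, dg i0 <= dg i)%N -> (m <= dg i0)%N ->
  (forall j, dg (fintype.lift i0 (s j)) < eg j)%N ->
  dg i0 = (\sum_j (eg j - dg (fintype.lift i0 (s j))))%N ->
  (\sum_i dg i = \sum_j eg j)%N /\
  (\sum_i dg i ^ 2 + m * m.+1 <= \sum_j eg j ^ 2)%N.
Proof.
move=> mind mD lt D.
pose d j := dg (fintype.lift i0 (s j)); pose u j := (eg j - d j)%N.
have e_du j : eg j = (d j + u j)%N by apply/esym/subnKC/ltnW/lt.
have reidx (F : nat -> nat) : (\sum_i F (dg i) = F (dg i0) + \sum_j F (d j))%N.
  rewrite (bigD1_ord i0) //=; congr (_ + _)%N.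
  by rewrite (reindex_inj (@perm_inj _ s)).
have Du : (\sum_j u j = dg i0)%N by rewrite [RHS]D.
split.
  rewrite (reidx id) -Du -big_split; apply: eq_bigr => j _.
  by rewrite /= addnC e_du.
rewrite (reidx (fun x => x ^ 2)%N).
have step j : (d j ^ 2 + 2 * dg i0 * u j + u j <= eg j ^ 2)%N.
  rewrite e_du sqrnD -!addnA leq_add2l addnC leq_add //.
    by apply: leq_pmulr; rewrite /u subn_gt0; exact: lt.
  by rewrite -mulnA leq_mul2l leq_mul // mind.
apply: leq_trans (leq_sum _ (fun j _ => step j)).
rewrite 2!big_split /= -big_distrr /= Du.
have q : (m * m.+1 <= dg i0 * (dg i0).+1)%N by rewrite leq_mul.
apply: (leq_trans (leq_add (leqnn _) q)).
rewrite mulnS mul2n -addnn mulnDl [(dg i0 ^ 2 + _)%N]addnC -!addnA leq_add2l.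
by rewrite [(dg i0 + _)%N]addnC.
Qed.

Section Core.
Variables (K : closedFieldType) (n nu : nat) (I : idealr {mpoly K[n.+1]}).
Local Notation S := {mpoly K[n.+1]}.
Variables (b : 'cV[S]_nu) (dg : 'I_nu -> nat).
Hypothesis bh : forall i, b i 0 \is (dg i).-homog.
Hypothesis bne : forall i, b i 0 != 0.
Hypothesis minb : minimal_gens b.
Hypothesis genI : forall p, p \in I <-> exists c : 'rV_nu, p = (c *m b) 0 0.
Hypothesis pd : proj_dim_le {ideal_quot I} 2.
Variable i0 : 'I_nu.
Variable t : nat.
Hypothesis ines : forall mu : 'X_{1..n.+1}, (t <= mdeg mu)%N ->
  exists2 w : 'rV[S]_nu, w *m b = 0 & w 0 i0 = 'X_[mu].

(** The entries of the relation matrix in column i0 are forms of positive degree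
    that generate an ideal containing all monomials of degree at least t; so
    there are at least n + 1 of them, n + 1 being the number of variables.  The
    other bounds follow from the number of rows of the matrix. *)
Lemma inessential_bounds :
  [/\ (n.+1 < nu)%N, forall i, (n < dg i)%N &
      height I 2 -> forall e, is_multiplicity I e -> (n.+1 * n.+2)%:R / 2 <= e].
Proof.
have [m [z [eg [hz freez]]]] := free_graded_syzygies bh genI pd minb.
have [zb zfree zspan] := freez.
case: nu b dg i0 ines z hz freez zb zfree zspan bh bne minb genI
  => [|k] b' dg' i0'; first by case: i0'.
move=> ines' z hz freez zb zfree zspan bh' bne' minb' genI'.
have mk := syzygies_row_number (bne' 0) zb zfree zspan.
subst m.
have nk : (n < k)%N.
  (* any positive degree serves for an entry 0 *)
  pose kd j := if z j i0' == 0 then 1%N else (eg j - dg' i0')%N.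
  apply: (@krull_height_bound _ _ _ (fun j => z j i0') kd t).
  - move=> j; rewrite /kd; case: eqP => [->|/eqP z0]; first exact: dhomog0.
    have lt := syz_entry_lt minb' hz freez z0.
    have /rowP/(_ i0') := hz j; rewrite !mxE /hpart (ltnW lt) => <-.
    exact: pihomogP.
  - move=> j; rewrite /kd; case: eqP => // /eqP z0.
    by rewrite subn_gt0 (syz_entry_lt minb' hz freez z0).
  move=> mu /ines' [w wb wi]; have [r hr] := zspan _ wb.
  by exists (r 0); rewrite -wi hr mxE.
have dk i : (k <= dg' i)%N.
  have [F [phi [_ _ [g g0 hg]]]] := degree_numerics bh' bne' minb' hz freez.
  have [_ [s hs ->]] := hg i; apply: leq_trans (leq_addl _ _).
  rewrite -[X in (X <= _)%N](card_ord k) -sum1_card; apply: leq_sum => j _.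
  by rewrite subn_gt0.
split=> // [i|hI e [H [Q [t0 [hH hQ ->]]]]]; first exact: leq_trans (dk i).
pose i1 := [arg min_(i < i0') dg' i].
have min1 i : (dg' i1 <= dg' i)%N by rewrite /i1; case: arg_minnP => // j _; apply.
have [s hs hd] := degree_formula bh' bne' minb' hz freez genI' hI i1.
have [sum1 sum2] := degree_sums min1 (dk i1) hs hd.
apply: (multiplicity_lower_bound (m := k) (dg := dg') (eg := eg)) => //.
- move=> t'; have [sq [hsq <-]] := hH t'.
  exact: (hilbert_function_count bh' genI' hz freez).
- by move=> i; apply: leq_trans (dk i).
by move=> j; apply: leq_trans (ltnW (hs j)); apply: leq_trans nk (dk _).
Qed.
End Core.

Theorem corollary3p1 (K : closedFieldType) (n : nat) (I : idealr {mpoly K[n]}) :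
  homogeneous_ideal I ->
  perfect_of_height2 I ->
  [\/ exists k : nat, is_nu I k /\ (k < n + 1)%N,
      exists a : nat, is_alpha I a /\ (a < n)%N
    | exists e : rat, is_multiplicity I e /\ e < (n * (n + 1))%:R / 2] ->
  forall B : seq {mpoly K[n]}, standard_basis I B ->
  {in B, forall f, essential B f}.
Proof.
move=> _ [hI [pd _]] cond B sB f fB ines.
case: n I hI pd cond B sB f fB ines => [|n] I hI pd cond B sB f fB ines.
  have f0 : f != 0 by apply: contraTneq fB => ->; exact: gen_neq0 sB.
  have fI : f \in I by rewrite -(nth_index 0 fB); exact: gen_in.
  have : 1 \in I; last by rewrite idealr1.
  have fE := nvar0_mpolyC f; set c := f@_0 in fE.
  have c0 : c != 0 by apply: contraNneq f0 => c0; rewrite fE c0 mpolyC0.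
  rewrite (_ : 1 = (c^-1)%:MP * f); first exact: idealMr.
  by rewrite [f in RHS]fE -mpolyCM mulVf // mpolyC1.
have i0B := fB; rewrite -index_mem in i0B.
rewrite -(nth_index 0 fB) in ines.
have [t ht] := inessential_monomials ines i0B.
have ht' (mu : 'X_{1..n.+1}) : (t <= mdeg mu)%N ->
    exists2 w : 'rV_(size B), w *m gen_col B = 0 & w 0 (Ordinal i0B) = 'X_[mu].
  by move=> /ht [w wb wi]; exists w => //; apply: wi.
have [nu_lt dg_lt mult] := inessential_bounds (@gen_homog _ _ _ _ sB)
  (gen_neq0_at sB) (gen_minimal sB) (gen_ideal sB) pd ht'.
case: cond => [[k [[B' [sB' <-]] lt]]|[k [[B' [sB' [g gB' hg] _]] lt]]|[e [he]]].
- have := leq_trans nu_lt (standard_basis_size sB sB').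
  by rewrite -addn1 leqNgt lt.
- have g0 : g != 0 by apply: contraTneq gB' => ->; exact: gen_neq0 sB'.
  have gI : g \in I by rewrite -(nth_index 0 gB'); exact: gen_in.
  have [i hi] := form_deg_ge sB gI hg g0.
  by have := leq_trans (dg_lt i) (leq_trans hi lt); rewrite ltnn.
by rewrite addn1 ltNge (mult hI e he).
Qed.
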